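(* Let $\mathcal{F}$ be a nonempty finite subcollection of $\mathcal{M}(\mathbb{D})$ whose tangency graph $T(\mathcal{F})$ is the complete directed graph on $|\mathcal{F}|$ vertices. Then $\dim\Lambda(\mathcal{F})=0$ if $\gamma_f\ge1$ for all $f\in\mathcal{F}$; $\dim\Lambda(\mathcal{F})=1$ if $\gamma_f<1$ for all $f\in\mathcal{F}$; and otherwise $$\dim\Lambda(\mathcal{F})=\min_{s\ge0}\frac{\log\left(\sum_{f\in\mathcal{F}}\gamma_f^{-s}\right)}{\log|\mathcal{F}|}.$$
   Context: $\mathbb{D}$ is the open unit disc; $\mathcal{M}(\mathbb{D})$ is the set of Möbius transformations $f$ with $f(\mathbb{D})\subset\mathbb{D}$, $f(\mathbb{D})\neq\mathbb{D}$. For $f\in\mathcal{M}(\mathbb{D})$: if $f(\mathbb{D})$ is internally tangent to $\mathbb{D}$ (at a unique point), $\alpha_f,\beta_f\in\partial\mathbb{D}$ are the unique points with $f(\alpha_f)=\beta_f$; otherwise $\alpha_f=0$, $\beta_f=\infty$. Set $\gamma_f=1/|f'(\alpha_f)|$. The tangency graph $T(\mathcal{F})$ is the directed graph with vertex set $\mathcal{F}$ and a directed edge from $f$ to $g$ iff $\alpha_f=\beta_g$. The complete directed graph has a directed edge from every vertex to every vertex, including a loop at each vertex. $\Omega(\mathcal{F})$ is the set of all sequences $(f_n)_{n\ge1}$ in $\mathcal{F}$ with metric $d((f_n),(g_n))=|\mathcal{F}|^{-k}$, $k=\min\{i:f_i\ne g_i\}$. $\Lambda(\mathcal{F})$ is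 the set of $(f_n)\in\Omega(\mathcal{F})$ for which $F_n=f_1\cdots f_n$ is of limit-disc type, i.e. $\bigcap_n F_n(\overline{\mathbb{D}})$ is a closed disc of positive radius rather than a point. $\dim$ is Hausdorff dimension with respect to $d$.
   Formalization: The formal statement assumes |F| ≥ 2 instead of F nonempty: for the single map f(z) = z/(2−z), with γ_f = 1/2, Λ(F) is one point of dimension 0, not 1. *)

(* Defs.v *)
From Stdlib Require Import Reals Lra Lia Classical ClassicalEpsilon.
Open Scope R_scope.

Definition C : Type := (R * R)%type.
Definition C0 : C := (0, 0).
Definition Cadd (z w : C) : C := (fst z + fst w, snd z + snd w).
Definition Csub (z w : C) : C := (fst z - fst w, snd z - snd w).
Definition Cmul (z w : C) : C :=
  (fst z * fst w - snd z * snd w, fst z * snd w + snd z * fst w).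
Definition Cinv (z : C) : C :=
  let n := fst z * fst z + snd z * snd z in (fst z / n, - snd z / n).
Definition Cdiv (z w : C) : C := Cmul z (Cinv w).
Definition Cnorm (z : C) : R := sqrt (fst z * fst z + snd z * snd z).

Record Mob := mkMob { ma : C; mb : C; mc : C; md : C }.

Definition mob_eval (m : Mob) (z : C) : C :=
  Cdiv (Cadd (Cmul (ma m) z) (mb m)) (Cadd (Cmul (mc m) z) (md m)).

Definition mob_det (m : Mob) : C := Csub (Cmul (ma m) (md m)) (Cmul (mb m) (mc m)).

Definition mob_deriv_norm (m : Mob) (z : C) : R :=
  Cnorm (mob_det m) / (Cnorm (Cadd (Cmul (mc m) z) (md m)) ^ 2).

Definition in_MD (m : Mob) : Prop :=
  mob_det m <> C0 /\
  (forall z, Cnorm z < 1 ->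
     Cadd (Cmul (mc m) z) (md m) <> C0 /\ Cnorm (mob_eval m z) < 1) /\
  (exists w, Cnorm w < 1 /\ forall z, Cnorm z < 1 -> mob_eval m z <> w).

(** f(closed D) is internally tangent to the unit circle *)
Definition tangent (m : Mob) : Prop :=
  exists z, Cnorm z = 1 /\ Cnorm (mob_eval m z) = 1.

(** alpha_f (in C) and beta_f (in C u {oo}, with None = oo) *)
Definition alpha (m : Mob) : C :=
  match excluded_middle_informative (tangent m) with
  | left _ => epsilon (inhabits C0)
                (fun z => Cnorm z = 1 /\ Cnorm (mob_eval m z) = 1)
  | right _ => C0
  end.

Definition beta (m : Mob) : option C :=
  match excluded_middle_informative (tangent m) with
  | left _ => Some (mob_eval m (alpha m))
  | right _ => None
  end.

Definition gamma (m : Mob) : R := 1 / mob_deriv_norm m (alpha m).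

(** * The family F = {fam 0, ..., fam (N-1)} and sequence space *)
(** F_n = f_1 o ... o f_n, where f_k = fam (w (k-1)) *)
Fixpoint compF (fam : nat -> Mob) (w : nat -> nat) (n : nat) (z : C) : C :=
  match n with
  | O => z
  | S k => compF fam w k (mob_eval (fam (w k)) z)
  end.

Definition limit_disc (fam : nat -> Mob) (w : nat -> nat) : Prop :=
  exists (c : C) (rho : R), 0 < rho /\
    forall z : C,
      (forall n, (1 <= n)%nat ->
         exists u, Cnorm u <= 1 /\ compF fam w n u = z)
      <-> Cnorm (Csub z c) <= rho.

Definition Omega (N : nat) (w : nat -> nat) : Prop := forall n, (w n < N)%nat.

Definition Lambda (N : nat) (fam : nat -> Mob) (w : nat -> nat) : Prop :=
  Omega N w /\ limit_disc fam w.

(** * Hausdorff dimension for the metric d(x,y) = N^{-k},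
      k = min{i >= 1 : x_i <> y_i}  (sequences are 0-indexed here) *)
Definition dist_le (N : nat) (x y : nat -> nat) (r : R) : Prop :=
  forall k, (forall i, (i < k)%nat -> x i = y i) -> x k <> y k ->
    / (INR N ^ (S k)) <= r.

Definition hpow (r s : R) : R :=
  if Rlt_dec 0 r then Rpower r s
  else if Req_EM_T s 0 then 1 else 0.

(** H^s(E) = 0, i.e. for every delta > 0, H^s_delta(E) = 0: for all eps > 0
    there is a countable cover by sets U_i of diameter <= r_i <= delta with
    sum_i diam^s <= eps (empty sets contribute 0). *)
Definition Hnull (N : nat) (s : R) (E : (nat -> nat) -> Prop) : Prop :=
  forall delta eps, 0 < delta -> 0 < eps ->
  exists (U : nat -> (nat -> nat) -> Prop) (r c : nat -> R),
    (forall i,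
       ((exists x, U i x) ->
          0 <= r i <= delta /\
          (forall x y, U i x -> U i y -> dist_le N x y (r i)) /\
          c i = hpow (r i) s) /\
       (~ (exists x, U i x) -> c i = 0)) /\
    (forall x, E x -> exists i, U i x) /\
    (exists l, infinite_sum c l /\ l <= eps).

Definition is_glb (P : R -> Prop) (m : R) : Prop :=
  (forall s, P s -> m <= s) /\ (forall y, (forall s, P s -> y <= s) -> y <= m).

Definition hausdorff_dim (N : nat) (E : (nat -> nat) -> Prop) (d : R) : Prop :=
  is_glb (fun s => 0 <= s /\ Hnull N s E) d.

Definition phi (N : nat) (fam : nat -> Mob) (s : R) : R :=
  ln (sum_f_R0 (fun i => Rpower (gamma (fam i)) (- s)) (N - 1)) / ln (INR N).

(* Main.v *)
(* Completeness of the tangency graph forces all the maps to fix one point p of the unit circle. In the coordinate p / (p - z), which sends p to infinity and the unit disc to the half-plane Re w > 1/2, each f becomes w |-> gamma_f w + b_f. Hence F_n maps the closed disc onto the disc Re w >= T_n, where T_n - 1/2 is the sum over k < n of gamma_{f_1} ... gamma_{f_k} times a number that depends only on f_{k+1} and stays between two positive bounds; so F_n is of limit-disc type if and only if the products gamma_{f_1} ... gamma_{f_k} are summable.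

   Put f(s) = log (sum of gamma^{-s}). Upper bound: a sequence in Lambda has infinitely many prefixes with product less than 1, and at most exp (n f(s)) words of length n have this property. Lower bound: take s slightly larger than a minimizer s0 of f and the Bernoulli measure with weights proportional to gamma^{-s}. Its likelihood ratios against the measures at s0 and at s + h are martingales; the first being bounded forces the products to decay exponentially, since f(s0) < f(s), and the second bounds the mass of a cylinder from above. Choosing letters greedily so that these two martingales plus the conditional mass of a cover of small content never increase produces a point of Lambda outside the cover. *)

Require Import Defs.
From Stdlib Require Import Arith Reals Lra Lia Classical ClassicalEpsilon List.
(* [Reals] has a function [C]; this makes [C] the complex plane again. *)
Import ListNotations Defs.
Open Scope R_scope.

(** * Finite sums, series with nonnegative terms, monotonicity of exp and ln *)

Lemma sum_f_R0_nonneg (g : nat -> R) (m : nat) :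
  (forall d, (d <= m)%nat -> 0 <= g d) -> 0 <= sum_f_R0 g m.
Proof.
  intros Hg. induction m as [|m IH]; simpl; [apply Hg; lia|].
  apply Rplus_le_le_0_compat; [apply IH; intros; apply Hg|apply Hg]; lia.
Qed.

Lemma sum_f_R0_ge_term (g : nat -> R) (m d : nat) :
  (forall d, (d <= m)%nat -> 0 <= g d) -> (d <= m)%nat -> g d <= sum_f_R0 g m.
Proof.
  induction m as [|m IH]; intros Hg Hd; simpl.
  - replace d with 0%nat by lia. lra.
  - destruct (Nat.eq_dec d (S m)) as [->|].
    + assert (0 <= sum_f_R0 g m) by (apply sum_f_R0_nonneg; intros; apply Hg; lia). lra.
    + assert (g d <= sum_f_R0 g m) by (apply IH; [intros; apply Hg|]; lia).
      assert (0 <= g (S m)) by (apply Hg; lia). lra.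
Qed.

Lemma sum_f_R0_lt (g h : nat -> R) (m j : nat) :
  (forall d, (d <= m)%nat -> g d <= h d) -> (j <= m)%nat -> g j < h j ->
  sum_f_R0 g m < sum_f_R0 h m.
Proof.
  intros Hle Hj Hlt.
  assert (H : (h j - g j) <= sum_f_R0 (fun d => h d - g d) m).
  { apply (sum_f_R0_ge_term (fun d => h d - g d)); auto.
    intros d Hd. specialize (Hle d Hd). lra. }
  rewrite minus_sum in H. lra.
Qed.

Lemma sum_f_R0_scal_l (g : nat -> R) (x : R) (m : nat) :
  sum_f_R0 (fun d => x * g d) m = x * sum_f_R0 g m.
Proof. rewrite scal_sum. apply sum_eq. intros; ring. Qed.

Lemma sum_f_R0_swap (g : nat -> nat -> R) (m K : nat) :
  sum_f_R0 (fun d => sum_f_R0 (fun i => g d i) K) m =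
  sum_f_R0 (fun i => sum_f_R0 (fun d => g d i) m) K.
Proof.
  induction m as [|m IH]; simpl; [reflexivity|].
  rewrite IH, <- plus_sum. reflexivity.
Qed.

Lemma sum_f_R0_incr (g : nat -> R) (m n : nat) :
  (forall i, 0 <= g i) -> (m <= n)%nat -> sum_f_R0 g m <= sum_f_R0 g n.
Proof.
  intros Hg Hmn. induction Hmn as [|n _ IH]; [lra|].
  simpl. specialize (Hg (S n)). lra.
Qed.

Lemma sum_f_R0_indicator (g : nat -> R) (m a : nat) :
  (a <= m)%nat ->
  sum_f_R0 (fun d => if Nat.eq_dec a d then g d else 0) m = g a.
Proof.
  assert (H0 : forall k, (k < a)%nat ->
    sum_f_R0 (fun d => if Nat.eq_dec a d then g d else 0) k = 0).
  { intros k. induction k as [|k IH]; intros Hk; simpl.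
    - destruct (Nat.eq_dec a 0); [lia|reflexivity].
    - rewrite IH by lia. destruct (Nat.eq_dec a (S k)); [lia|ring]. }
  intros Ha. induction m as [|m IH]; simpl.
  - destruct (Nat.eq_dec a 0) as [->|]; [reflexivity|lia].
  - destruct (Nat.eq_dec a (S m)) as [->|].
    + rewrite H0 by lia. ring.
    + rewrite IH by lia. ring.
Qed.

Lemma infinite_sum_bounded (c : nat -> R) (B : R) :
  (forall i, 0 <= c i) -> (forall n, sum_f_R0 c n <= B) ->
  exists l, infinite_sum c l /\ l <= B /\ forall n, sum_f_R0 c n <= l.
Proof.
  intros Hc HB.
  assert (Hg : Un_growing (sum_f_R0 c)) by (intros n; simpl; specialize (Hc (S n)); lra).
  destruct (growing_cv _ Hg) as [l Hl].
  { exists B. intros x [n ->]. apply HB. }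
  assert (Hln : forall n, sum_f_R0 c n <= l) by (intros; now apply growing_ineq).
  exists l; repeat split; auto.
  apply Rnot_lt_le. intros Hlt.
  destruct (Hl (l - B)) as [n Hn]; [lra|].
  specialize (Hn n (le_n n)). unfold Rdist in Hn. apply Rabs_def2 in Hn.
  specialize (HB n). lra.
Qed.

Lemma infinite_sum_partial_le (c : nat -> R) (l : R) (n : nat) :
  (forall i, 0 <= c i) -> infinite_sum c l -> sum_f_R0 c n <= l.
Proof.
  intros Hc Hl. apply (growing_ineq (sum_f_R0 c)); [|exact Hl].
  intros k. simpl. specialize (Hc (S k)). lra.
Qed.

Lemma exp_le_compat (x y : R) : x <= y -> exp x <= exp y.
Proof. intros [H| ->]; [left; now apply exp_increasing|lra]. Qed.

Lemma ln_le_compat (x y : R) : 0 < x -> x <= y -> ln x <= ln y.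
Proof. intros Hx [H| ->]; [left; now apply ln_increasing|lra]. Qed.

(** * Words and prefixes of sequences *)

(** With [l d] the logarithm of gamma for the letter [d], this is the logarithm of the product of
    the gammas along the word. *)
Definition wsum (l : nat -> R) (v : list nat) : R :=
  fold_right (fun d r => l d + r) 0 v.

Definition prefix (w : nat -> nat) (n : nat) : list nat := map w (seq 0 n).

Lemma wsum_snoc (l : nat -> R) (v : list nat) (d : nat) :
  wsum l (v ++ [d]) = wsum l v + l d.
Proof. induction v as [|a v IH]; simpl; [|rewrite IH]; ring. Qed.

Lemma length_snoc (v : list nat) (d : nat) : length (v ++ [d]) = S (length v).
Proof. rewrite length_app; simpl; lia. Qed.

Lemma prefix_S (w : nat -> nat) (n : nat) : prefix w (S n) = prefix w n ++ [w n].
Proof. unfold prefix. now rewrite seq_S, map_app. Qed.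

Lemma length_prefix (w : nat -> nat) (n : nat) : length (prefix w n) = n.
Proof. unfold prefix. now rewrite length_map, length_seq. Qed.

Lemma prefix_ext (x y : nat -> nat) (n : nat) :
  prefix x n = prefix y n <-> forall i, (i < n)%nat -> x i = y i.
Proof.
  unfold prefix. split.
  - intros H i Hi. apply (ext_in_map H). apply in_seq; lia.
  - intros H. apply map_ext_in. intros i Hi%in_seq. apply H; lia.
Qed.

Lemma prefix_Forall (x : nat -> nat) (n : nat) (Q : nat -> Prop) :
  (forall i, Q (x i)) -> Forall Q (prefix x n).
Proof.
  intros H. apply Forall_forall. intros d Hd.
  apply in_map_iff in Hd. destruct Hd as [i [<- _]]. apply H.
Qed.

(** * Pressure *)

(** For [l d = ln (gamma (fam d))] this is convertible with the sum of gamma^{-s} inside [phi]. The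
    letters are 0, ..., [m], so the alphabet has [S m] elements. *)
Definition psum (m : nat) (l : nat -> R) (s : R) : R :=
  sum_f_R0 (fun d => exp (- s * l d)) m.

Definition pressure (m : nat) (l : nat -> R) (s : R) : R := ln (psum m l s).

Lemma psum_pos (m : nat) (l : nat -> R) (s : R) : 0 < psum m l s.
Proof.
  apply Rlt_le_trans with (exp (- s * l 0%nat)); [apply exp_pos|].
  apply (sum_f_R0_ge_term (fun d => exp (- s * l d))); [|lia].
  intros; left; apply exp_pos.
Qed.

Lemma exp_pressure (m : nat) (l : nat -> R) (s : R) :
  exp (pressure m l s) = psum m l s.
Proof. apply exp_ln, psum_pos. Qed.

Lemma pressure_le_iff (m : nat) (l : nat -> R) (s t : R) :
  pressure m l s <= pressure m l t <-> psum m l s <= psum m l t.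
Proof.
  split; intros H.
  - rewrite <- !exp_pressure. now apply exp_le_compat.
  - apply ln_le_compat; [apply psum_pos|exact H].
Qed.

Lemma pressure_0 (m : nat) (l : nat -> R) : pressure m l 0 = ln (INR (S m)).
Proof.
  unfold pressure, psum. f_equal.
  rewrite (sum_eq _ (fun _ => 1)).
  - rewrite sum_cte. ring.
  - intros; rewrite Ropp_0, Rmult_0_l. apply exp_0.
Qed.

Lemma exp_scal_derivable (x s : R) :
  derivable_pt_lim (fun s => exp (- s * x)) s (exp (- s * x) * - x).
Proof.
  apply (derivable_pt_lim_comp (fun s => - s * x) exp s (- x) (exp (- s * x)));
    [|apply derivable_pt_lim_exp].
  replace (- x) with (-1 * x + - s * 0) by ring.
  apply (derivable_pt_lim_mult (fun s => - s) (fun _ => x)).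
  - apply (derivable_pt_lim_opp id), derivable_pt_lim_id.
  - apply derivable_pt_lim_const.
Qed.

Lemma psum_derivable (m : nat) (l : nat -> R) (s : R) : derivable_pt (psum m l) s.
Proof.
  unfold psum. induction m as [|m IH]; simpl.
  - eexists. apply exp_scal_derivable.
  - apply (derivable_pt_plus (fun s => sum_f_R0 (fun d => exp (- s * l d)) m)
             (fun s => exp (- s * l (S m)))); [exact IH|].
    eexists. apply exp_scal_derivable.
Qed.

Lemma pressure_derivable (m : nat) (l : nat -> R) (s : R) :
  derivable_pt (pressure m l) s.
Proof.
  apply (derivable_pt_comp (psum m l) ln); [apply psum_derivable|].
  eexists. apply derivable_pt_lim_ln, psum_pos.
Qed.

Lemma pressure_continuity (m : nat) (l : nat -> R) : continuity (pressure m l).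
Proof. intros s. apply derivable_continuous_pt, pressure_derivable. Qed.

(** The term of [j] is already at least 1, and a second letter pushes the sum strictly above 1. *)
Lemma pressure_pos (m j : nat) (l : nat -> R) (s : R) :
  (1 <= m)%nat -> (j <= m)%nat -> l j < 0 -> 0 <= s -> 0 < pressure m l s.
Proof.
  intros Hm Hj Hl Hs. unfold pressure. rewrite <- ln_1.
  apply ln_increasing; [lra|].
  apply Rle_lt_trans with (exp (- s * l j)).
  - rewrite <- exp_0. apply exp_le_compat. nra.
  - unfold psum.
    rewrite <- (sum_f_R0_indicator (fun d => exp (- s * l d)) m j Hj).
    assert (Hk : exists k, (k <= m)%nat /\ j <> k).
    { destruct (Nat.eq_dec j 0); [exists 1%nat|exists 0%nat]; lia. }
    destruct Hk as [k [Hk Hjk]]. apply (sum_f_R0_lt _ _ m k); [|exact Hk|].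
    + intros d _. destruct (Nat.eq_dec j d); [lra|left; apply exp_pos].
    + destruct (Nat.eq_dec j k); [lia|apply exp_pos].
Qed.

(** Beyond [X] the term of [j] alone exceeds [S m], the value of [psum] at 0, so the minimum over
    the compact interval from 0 to [X] is global. *)
Lemma pressure_min_exists (m j : nat) (l : nat -> R) :
  (j <= m)%nat -> l j < 0 ->
  exists s0, 0 <= s0 /\ forall s, 0 <= s -> pressure m l s0 <= pressure m l s.
Proof.
  intros Hj Hl.
  set (X := Rmax 0 (ln (INR (S m)) / - l j)).
  assert (HX : 0 <= X) by apply Rmax_l.
  destruct (continuity_ab_min (pressure m l) 0 X HX) as [s0 [Hmin Hs0]].
  { intros c _. apply pressure_continuity. }
  exists s0. split; [lra|]. intros s Hs.
  destruct (Rle_lt_dec s X) as [Hle|Hgt]; [apply Hmin; lra|].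
  apply Rle_trans with (pressure m l 0); [apply Hmin; lra|].
  rewrite pressure_0. unfold pressure.
  rewrite <- (ln_exp (ln (INR (S m)))). apply ln_le_compat; [apply exp_pos|].
  apply Rle_trans with (exp (- s * l j)).
  - apply exp_le_compat.
    assert (ln (INR (S m)) / - l j <= X) by apply Rmax_r.
    apply (Rmult_le_reg_r (/ - l j)); [apply Rinv_0_lt_compat; lra|].
    replace (- s * l j * / - l j) with s by (field; lra).
    unfold Rdiv in *. lra.
  - apply (sum_f_R0_ge_term (fun d => exp (- s * l d))); [|exact Hj].
    intros; left; apply exp_pos.
Qed.

(** Strict convexity of [psum]: if the value at [s] were no larger than at [s0], the midpoint would
    lie strictly below the minimum. *)
Lemma pressure_min_strict (m j : nat) (l : nat -> R) (s0 s : R) :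
  (j <= m)%nat -> l j < 0 -> 0 <= s0 ->
  (forall s, 0 <= s -> pressure m l s0 <= pressure m l s) ->
  s0 < s -> pressure m l s0 < pressure m l s.
Proof.
  intros Hj Hl Hs0 Hmin Hs.
  apply Rnot_le_lt. intros Hle%pressure_le_iff.
  assert (Hmid : psum m l s0 <= psum m l ((s0 + s) / 2)).
  { apply pressure_le_iff, Hmin. lra. }
  assert (Hlt : psum m l ((s0 + s) / 2) < / 2 * (psum m l s0 + psum m l s)); [|lra].
  unfold psum. rewrite <- plus_sum, <- sum_f_R0_scal_l.
  (* With x and y the exponentials at half the exponents, the midpoint inequality for each letter is
     2xy <= x^2 + y^2, strict for [j] because x < y there. *)
  assert (Hsplit : forall d,
    exp (- ((s0 + s) / 2) * l d) = exp (- s0 * l d / 2) * exp (- s * l d / 2) /\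
    exp (- s0 * l d) = exp (- s0 * l d / 2) * exp (- s0 * l d / 2) /\
    exp (- s * l d) = exp (- s * l d / 2) * exp (- s * l d / 2)).
  { intros d. rewrite <- !exp_plus. repeat split; f_equal; field. }
  apply (sum_f_R0_lt _ _ m j); auto.
  - intros d _. destruct (Hsplit d) as [-> [-> ->]].
    assert (0 <= (exp (- s0 * l d / 2) - exp (- s * l d / 2)) ^ 2) by apply pow2_ge_0.
    nra.
  - assert (Hd : exp (- s0 * l j / 2) < exp (- s * l j / 2)).
    { apply exp_increasing. nra. }
    destruct (Hsplit j) as [-> [-> ->]]. nra.
Qed.

(* At an interior minimum the derivative of the pressure vanishes; at [s0 = 0] the factor [s0] does. *)
Lemma pressure_min_slope (m : nat) (l : nat -> R) (s0 e : R) :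
  0 <= s0 -> (forall s, 0 <= s -> pressure m l s0 <= pressure m l s) -> 0 < e ->
  exists h, 0 < h /\ s0 / h * (pressure m l (s0 + h) - pressure m l s0) < e.
Proof.
  intros Hs0 Hmin He. destruct (Req_dec s0 0) as [->|Hne].
  { exists 1. split; [lra|]. unfold Rdiv. rewrite !Rmult_0_l. exact He. }
  destruct (pressure_derivable m l s0) as [y Hy] eqn:Hpr.
  assert (Hy0 : y = 0).
  { change y with (derive_pt (pressure m l) s0 (exist _ y Hy)).
    apply (deriv_minimum (pressure m l) 0 (s0 + 1)); [lra|lra|].
    intros; apply Hmin; lra. }
  subst y. clear Hpr.
  destruct (Hy (e / s0)) as [dl Hdl]; [apply Rdiv_lt_0_compat; lra|].
  destruct dl as [dl Hdl0]. simpl in Hdl.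
  exists (dl / 2). split; [lra|].
  specialize (Hdl (dl / 2)).
  assert (H : Rabs ((pressure m l (s0 + dl / 2) - pressure m l s0) / (dl / 2) - 0) < e / s0).
  { apply Hdl; [lra|]. rewrite Rabs_pos_eq; lra. }
  rewrite Rminus_0_r in H.
  apply (Rle_lt_trans _ _ _ (Rle_abs _)) in H.
  apply (Rmult_lt_compat_r s0) in H; [|lra].
  replace (e / s0 * s0) with e in H by (field; lra).
  unfold Rdiv in *. lra.
Qed.

(** * Horodiscs *)

Definition C1 : C := (1, 0).
Definition Copp (z : C) : C := (- fst z, - snd z).

Lemma Csq_neq_0 (z : C) : z <> C0 -> fst z * fst z + snd z * snd z <> 0.
Proof.
  destruct z as [x y]. unfold C0. simpl. intros Hz H. apply Hz.
  assert (x = 0) by nra. assert (y = 0) by nra. now subst.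
Qed.

Lemma C_field : field_theory C0 C1 Cadd Cmul Csub Copp Cdiv Cinv eq.
Proof.
  constructor.
  - constructor; unfold C0, C1, Cadd, Cmul, Csub, Copp; intros;
      repeat match goal with z : C |- _ => destruct z end; simpl;
      try reflexivity; f_equal; ring.
  - unfold C0, C1. intros H. injection H. lra.
  - reflexivity.
  - intros [x y] Hz%Csq_neq_0. unfold Cmul, Cinv, C1. simpl in *.
    f_equal; field; exact Hz.
Qed.

Add Field C_field_inst : C_field.

Definition Cdot (z w : C) : R := fst z * fst w + snd z * snd w.

Lemma Cnorm_sq (z : C) : Cnorm z * Cnorm z = Cdot z z.
Proof. apply sqrt_sqrt. unfold Cdot. nra. Qed.

Lemma Cnorm_nonneg (z : C) : 0 <= Cnorm z.
Proof. apply sqrt_pos. Qed.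

Lemma Cnorm_le_iff (z : C) (r : R) : 0 <= r -> Cnorm z <= r <-> Cdot z z <= r * r.
Proof.
  intros Hr. rewrite <- Cnorm_sq. pose proof (Cnorm_nonneg z). split; nra.
Qed.

Lemma Cnorm_lt_iff (z : C) (r : R) : 0 <= r -> Cnorm z < r <-> Cdot z z < r * r.
Proof.
  intros Hr. rewrite <- Cnorm_sq. pose proof (Cnorm_nonneg z). split; nra.
Qed.

Lemma Cnorm_eq_iff (z : C) (r : R) : 0 <= r -> Cnorm z = r <-> Cdot z z = r * r.
Proof.
  intros Hr. rewrite <- Cnorm_sq. pose proof (Cnorm_nonneg z). split; nra.
Qed.

Lemma Cnorm_mul (z w : C) : Cnorm (Cmul z w) = Cnorm z * Cnorm w.
Proof.
  apply Cnorm_eq_iff; [apply Rmult_le_pos; apply Cnorm_nonneg|].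
  replace (Cnorm z * Cnorm w * (Cnorm z * Cnorm w))
    with ((Cnorm z * Cnorm z) * (Cnorm w * Cnorm w)) by ring.
  rewrite !Cnorm_sq. unfold Cdot, Cmul. simpl. ring.
Qed.

Lemma Cnorm_pos (z : C) : z <> C0 -> 0 < Cnorm z.
Proof.
  intros Hz. apply sqrt_lt_R0. pose proof (Csq_neq_0 z Hz).
  assert (0 <= fst z * fst z + snd z * snd z) by nra. lra.
Qed.

Lemma Csub_0 (z w : C) : Csub z w = C0 -> z = w.
Proof. intros H. replace z with (Cadd (Csub z w) w) by ring. rewrite H. ring. Qed.

Lemma Cmul_neq_0 (z w : C) : z <> C0 -> w <> C0 -> Cmul z w <> C0.
Proof.
  intros Hz Hw H. apply Hz.
  replace z with (Cdiv (Cmul z w) w) by (field; exact Hw). rewrite H. field. exact Hw.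
Qed.

Lemma Cmul_neq_0_inv (z w : C) : Cmul z w <> C0 -> z <> C0 /\ w <> C0.
Proof. intros H; split; intros ->; apply H; ring. Qed.

(* [horodisc p (1/2)] is the closed unit disc; for larger [tau] these are the smaller closed discs tangent to it at [p]. *)
Definition horodisc (p : C) (tau : R) (z : C) : Prop :=
  tau * Cdot (Csub p z) (Csub p z) <= Cdot p (Csub p z).

(* Sends [p] to infinity and [horodisc p tau] to the half-plane [Re >= tau]. *)
Definition hcoord (p z : C) : C := Cdiv p (Csub p z).

Lemma Cdot_unit (p : C) (Hp : Cnorm p = 1) : Cdot p p = 1.
Proof. apply Cnorm_eq_iff in Hp; lra. Qed.

Lemma unit_neq_0 (p : C) (Hp : Cnorm p = 1) : p <> C0.
Proof. intros H. pose proof (Cdot_unit p Hp) as Hd. rewrite H in Hd. unfold Cdot, C0 in Hd. simpl in Hd. lra. Qed.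

Lemma horodisc_half (p : C) (Hp : Cnorm p = 1) (z : C) : horodisc p (1 / 2) z <-> Cnorm z <= 1.
Proof.
  rewrite Cnorm_le_iff by lra. pose proof (Cdot_unit p Hp) as Hd.
  unfold horodisc, Cdot, Csub in *. simpl. split; intros; nra.
Qed.

Lemma horodisc_center (p : C) (tau : R) : horodisc p tau p.
Proof. unfold horodisc, Cdot, Csub. simpl. nra. Qed.

(** Completing the square, with [k] the radius. This supplies the centre and radius that
    [limit_disc] asks for. *)
Lemma horodisc_disc (p : C) (Hp : Cnorm p = 1) (tau : R) (z : C) : 0 < tau ->
  horodisc p tau z <->
  Cnorm (Csub z (fst p * (1 - / (2 * tau)), snd p * (1 - / (2 * tau)))) <= / (2 * tau).
Proof.
  intros Ht. set (k := / (2 * tau)).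
  assert (Hk : 0 < k) by (apply Rinv_0_lt_compat; lra).
  assert (Htk : tau * k = 1 / 2) by (unfold k; field; lra).
  rewrite Cnorm_le_iff by lra.
  pose proof (Cdot_unit p Hp) as Hd. unfold horodisc, Cdot, Csub in *.
  destruct p as [a b], z as [x y]. simpl in *.
  set (u := a - x). set (v := b - y).
  replace (x - a * (1 - k)) with (k * a - u) by (unfold u; ring).
  replace (y - b * (1 - k)) with (k * b - v) by (unfold v; ring).
  assert (E : (k * a - u) * (k * a - u) + (k * b - v) * (k * b - v) - k * k
    = k * 2 * (tau * (u * u + v * v) - (a * u + b * v))).
  { replace (k * 2 * (tau * (u * u + v * v) - (a * u + b * v)))
      with (2 * (tau * k) * (u * u + v * v) - 2 * k * (a * u + b * v)) by ring.
    rewrite Htk. replace ((k * a - u) * (k * a - u) + (k * b - v) * (k * b - v) - k * k)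
      with (k * k * (a * a + b * b) - k * k + (u * u + v * v) - 2 * k * (a * u + b * v)) by ring.
    rewrite Hd. field. }
  split; intros H; nra.
Qed.

(** The real part of p / (p - z) is <p, p - z> / |p - z|^2; clearing the positive denominator turns
    disc conditions into half-plane conditions. *)
Lemma hcoord_dot (p : C) (z : C) : z <> p ->
  fst (hcoord p z) * Cdot (Csub p z) (Csub p z) = Cdot p (Csub p z) /\
  0 < Cdot (Csub p z) (Csub p z).
Proof.
  intros Hz.
  assert (Hn : Csub p z <> C0) by (intros H; apply Hz; symmetry; now apply Csub_0).
  pose proof (Csq_neq_0 _ Hn) as Hs. split.
  - unfold hcoord, Cdiv, Cmul, Cinv, Cdot in *. simpl fst in *. simpl snd in *. field. exact Hs.
  - unfold Cdot. nra.
Qed.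

Lemma horodisc_hcoord (p : C) (tau : R) (z : C) : z <> p ->
  horodisc p tau z <-> tau <= fst (hcoord p z).
Proof.
  intros Hz. destruct (hcoord_dot p z Hz) as [H1 H2]. unfold horodisc. rewrite <- H1.
  split; intros H; nra.
Qed.

Lemma open_disc_hcoord (p : C) (Hp : Cnorm p = 1) (z : C) : z <> p -> Cnorm z < 1 <-> 1 / 2 < fst (hcoord p z).
Proof.
  intros Hz. destruct (hcoord_dot p z Hz) as [H1 H2].
  rewrite Cnorm_lt_iff by lra. pose proof (Cdot_unit p Hp) as Hd.
  assert (E : Cdot z z = 1 - 2 * Cdot p (Csub p z) + Cdot (Csub p z) (Csub p z)).
  { rewrite <- Hd. unfold Cdot, Csub. simpl. ring. }
  rewrite E, <- H1. split; intros; nra.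
Qed.

Lemma hcoord_inv (p : C) (Hp : Cnorm p = 1) (w : C) : w <> C0 ->
  Csub p (Cdiv p w) <> p /\ hcoord p (Csub p (Cdiv p w)) = w.
Proof.
  intros Hw.
  assert (Hpw : Cdiv p w <> C0).
  { intros H. apply (unit_neq_0 p Hp). replace p with (Cmul (Cdiv p w) w) by (field; exact Hw).
    rewrite H. ring. }
  split.
  - intros H. apply Hpw. replace (Cdiv p w) with (Csub p (Csub p (Cdiv p w))) by ring.
    rewrite H. ring.
  - unfold hcoord. replace (Csub p (Csub p (Cdiv p w))) with (Cdiv p w) by ring.
    field. split; [exact Hw|exact (unit_neq_0 p Hp)].
Qed.

Lemma hcoord_inj (p : C) (Hp : Cnorm p = 1) (z w : C) : z <> p -> w <> p -> hcoord p z = hcoord p w -> z = w.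
Proof.
  intros Hz Hw H.
  assert (E : forall z, z <> p -> z = Csub p (Cdiv p (hcoord p z))).
  { intros x Hx. assert (Hn : Csub p x <> C0) by (intros H'; apply Hx; symmetry; now apply Csub_0).
    unfold hcoord. field. split; [exact Hn|exact (unit_neq_0 p Hp)]. }
  rewrite (E z Hz), (E w Hw), H. reflexivity.
Qed.

(** * Möbius maps fixing a boundary point, in the half-plane coordinate *)

Lemma Cdiv_0_r (z : C) : Cdiv z C0 = C0.
Proof.
  unfold Cdiv, Cmul, Cinv, C0. simpl. unfold Rdiv. f_equal; ring.
Qed.

Lemma real_affine_solve (A : R) (w b : C) : A <> 0 ->
  Cadd (Cmul (A, 0) ((fst w - fst b) / A, (snd w - snd b) / A)) b = w.
Proof.
  intros HA. destruct w, b. unfold Cadd, Cmul. simpl. f_equal; field; exact HA.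
Qed.

(* An affine map [w |-> A w + b] preserves [Re > 1/2] only if [A] is a nonnegative real. *)
Lemma half_plane_affine (a1 a2 b : R) :
  (forall x y, 1 / 2 < x -> 1 / 2 < a1 * x - a2 * y + b) ->
  a2 = 0 /\ 0 <= a1 /\ (0 < a1 -> 1 / 2 <= a1 / 2 + b).
Proof.
  intros H.
  assert (H2 : a2 = 0).
  { apply NNPP. intros Hne. specialize (H 1 ((a1 + b) / a2)).
    replace (a1 * 1 - a2 * ((a1 + b) / a2) + b) with 0 in H by (field; exact Hne). lra. }
  subst a2. split; [reflexivity|].
  assert (H' : forall x, 1 / 2 < x -> 1 / 2 < a1 * x + b).
  { intros x Hx. specialize (H x 0 Hx). lra. }
  split.
  - apply Rnot_lt_le. intros Hlt.
    assert (Hq : 0 <= Rabs b / - a1).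
    { apply Rmult_le_pos; [apply Rabs_pos|]. left. apply Rinv_0_lt_compat. lra. }
    specialize (H' (1 + Rabs b / - a1)).
    replace (a1 * (1 + Rabs b / - a1) + b) with (a1 - Rabs b + b) in H' by (field; lra).
    pose proof (Rle_abs b). lra.
  - intros Ha. apply Rnot_lt_le. intros Hlt.
    assert (Hq : 0 < (1 / 2 - b - a1 / 2) / a1) by (apply Rdiv_lt_0_compat; lra).
    specialize (H' (1 / 2 + (1 / 2 - b - a1 / 2) / a1)).
    replace (a1 * (1 / 2 + (1 / 2 - b - a1 / 2) / a1) + b) with (1 / 2) in H' by (field; lra).
    lra.
Qed.

(** [hcoord p] moves the fixed point to infinity, so the map becomes affine. Preserving the
    half-plane Re > 1/2 makes its linear coefficient a positive real, and omitting a point of the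
    disc makes the inequality for [b] strict. *)
Lemma mob_hcoord (m : Mob) (p : C) :
  Cnorm p = 1 -> in_MD m -> mob_eval m p = p ->
  exists A b, 0 < A /\ A = 1 / mob_deriv_norm m p /\ 1 / 2 < A / 2 + fst b /\
    forall z, Cnorm z <= 1 -> z <> p ->
      mob_eval m z <> p /\
      hcoord p (mob_eval m z) = Cadd (Cmul (A, 0) (hcoord p z)) b.
Proof.
  intros Hp [Hdet [Hin [w0 [Hw0 Hmiss]]]] Hfix.
  pose proof (unit_neq_0 p Hp) as Hp0.
  destruct m as [a b c d]. unfold mob_deriv_norm, mob_det in *.
  unfold mob_eval in *. cbn [ma mb mc md] in *.
  (* At a pole the totalised division returns 0, which is not the unit vector [p]. *)
  assert (Hden : Cadd (Cmul c p) d <> C0).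
  { intros H. rewrite H, Cdiv_0_r in Hfix. now apply Hp0. }
  assert (Hb : b = Csub (Cmul p (Cadd (Cmul c p) d)) (Cmul a p)).
  { rewrite <- Hfix at 1. field. exact Hden. }
  clear Hfix. subst b.
  set (al := Csub a (Cmul c p)).
  assert (Edet : Csub (Cmul a d) (Cmul (Csub (Cmul p (Cadd (Cmul c p) d)) (Cmul a p)) c)
    = Cmul al (Cadd (Cmul c p) d)) by (unfold al; ring).
  rewrite Edet in *. clear Edet.
  apply Cmul_neq_0_inv in Hdet. destruct Hdet as [Hal _].
  set (dn := Cadd (Cmul c p) d) in *.
  set (f := fun z => Cdiv (Cadd (Cmul a z) (Csub (Cmul p dn) (Cmul a p))) (Cadd (Cmul c z) d)) in *.
  (* These come from p - f(z) = al (p - z) / (c z + d) and c z + d = dn - c (p - z). *)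
  set (Ac := Cdiv dn al). set (bc := Cdiv (Copp (Cmul c p)) al).
  assert (Hsubp : forall z, z <> p -> Csub p z <> C0).
  { intros z Hz H. apply Hz. symmetry. now apply Csub_0. }
  assert (Hd : forall z, z <> p -> Cadd (Cmul c z) d =
    Cmul (Cmul (Csub p z) (Cdiv al p)) (Cadd (Cmul Ac (hcoord p z)) bc)).
  { intros z Hz. unfold Ac, bc, hcoord, dn. field. repeat split; auto. }
  assert (Hf : forall z, Cadd (Cmul c z) d <> C0 -> z <> p ->
    Csub p (f z) = Cdiv (Cmul al (Csub p z)) (Cadd (Cmul c z) d)).
  { intros z Hz Hzp. unfold f, al, dn. field. exact Hz. }
  assert (Haff : forall z, Cadd (Cmul c z) d <> C0 -> z <> p ->
    f z <> p /\ hcoord p (f z) = Cadd (Cmul Ac (hcoord p z)) bc).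
  { intros z Hz Hzp.
    assert (Hn : Csub p (f z) <> C0).
    { rewrite (Hf z Hz Hzp). intros H.
      apply (Cmul_neq_0 al (Csub p z)); auto.
      replace (Cmul al (Csub p z)) with
        (Cmul (Cdiv (Cmul al (Csub p z)) (Cadd (Cmul c z) d)) (Cadd (Cmul c z) d))
        by (field; exact Hz). rewrite H. ring. }
    split; [intros H; apply Hn; rewrite H; ring|].
    unfold hcoord at 1. rewrite (Hf z Hz Hzp). unfold Ac, bc, hcoord, dn.
    field. repeat split; auto. }
  assert (Hopen : forall z, Cnorm z < 1 -> z <> p) by (intros z Hz ->; lra).
  assert (Hre : forall z, Cnorm z < 1 -> 1 / 2 < fst (Cadd (Cmul Ac (hcoord p z)) bc)).
  { intros z Hz. destruct (Hin z Hz) as [Hz1 Hz2].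
    destruct (Haff z Hz1 (Hopen z Hz)) as [H1 <-].
    now apply (open_disc_hcoord p Hp). }
  assert (Hsurj : forall w, 1 / 2 < fst w -> exists z, Cnorm z < 1 /\ z <> p /\ hcoord p z = w).
  { intros w Hw. assert (Hw' : w <> C0) by (intros ->; simpl in Hw; lra).
    destruct (hcoord_inv p Hp w Hw') as [H1 H2].
    exists (Csub p (Cdiv p w)). repeat split; auto.
    apply (open_disc_hcoord p Hp); [exact H1|]. now rewrite H2. }
  destruct (half_plane_affine (fst Ac) (snd Ac) (fst bc)) as [HA2 [HA1 Hb]].
  { intros x y Hx. destruct (Hsurj (x, y) Hx) as [z [Hz [_ Hzw]]].
    specialize (Hre z Hz). rewrite Hzw in Hre.
    change (1 / 2 < (fst Ac * x - snd Ac * y) + fst bc) in Hre. exact Hre. }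
  assert (HAc : Ac = (fst Ac, 0)) by (destruct Ac; simpl in *; now subst).
  assert (HAal : dn = Cmul Ac al) by (unfold Ac; field; exact Hal).
  set (A := fst Ac) in *. clearbody A.
  assert (HA : 0 < A).
  { destruct HA1 as [|<-]; [assumption|]. exfalso. apply Hden.
    rewrite HAal, HAc. change (0, 0) with C0. ring. }
  specialize (Hb HA).
  (* With equality the affine map would send the half-plane onto itself, so the omitted point [w0]
     would have a preimage. *)
  assert (Hbs : 1 / 2 < A / 2 + fst bc).
  { destruct Hb as [|Hb]; [assumption|]. exfalso.
    assert (Hw0p := Hopen w0 Hw0).
    pose proof (proj1 (open_disc_hcoord p Hp w0 Hw0p) Hw0) as Hom.
    set (om := hcoord p w0) in *.
    destruct (Hsurj ((fst om - fst bc) / A, (snd om - snd bc) / A)) as [z [Hz [Hzp Hzw]]].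
    { change (1 / 2 < (fst om - fst bc) / A).
      apply (Rmult_lt_reg_r A); [exact HA|].
      replace ((fst om - fst bc) / A * A) with (fst om - fst bc) by (field; lra). lra. }
    apply (Hmiss z Hz). destruct (Hin z Hz) as [Hz1 _].
    destruct (Haff z Hz1 Hzp) as [H1 H2].
    apply (hcoord_inj p Hp); auto. fold (f z). rewrite H2. fold om.
    rewrite Hzw, HAc. apply real_affine_solve. lra. }
  (* [in_MD] excludes poles only in the open disc. On the circle, [Hd] gives the denominator as a
     nonzero multiple of the affine image, whose real part is positive. *)
  assert (Hcl : forall z, Cnorm z <= 1 -> z <> p -> Cadd (Cmul c z) d <> C0).
  { intros z Hz Hzp. rewrite (Hd z Hzp).
    apply (horodisc_half p Hp), (horodisc_hcoord p _ _ Hzp) in Hz.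
    assert (Hdp : Cdiv al p <> C0).
    { intros H1. apply Hal. replace al with (Cmul (Cdiv al p) p) by (field; auto).
      rewrite H1. ring. }
    apply Cmul_neq_0; [apply Cmul_neq_0; auto|].
    intros H1. apply (f_equal fst) in H1. rewrite HAc in H1.
    change (A * fst (hcoord p z) - 0 * snd (hcoord p z) + fst bc = 0) in H1. nra. }
  exists A, bc. split; [exact HA|]. split; [|split; [exact Hbs|]].
  (* The determinant is [al] times [dn], and [dn] is [A] times [al], so the derivative at [p] has
     norm |al| / |dn| = 1 / A. *)
  - rewrite Cnorm_mul. rewrite HAal, Cnorm_mul, HAc.
    assert (HnA : Cnorm (A, 0) = A).
    { apply Cnorm_eq_iff; [lra|]. unfold Cdot. simpl. ring. }
    rewrite HnA. pose proof (Cnorm_pos al Hal). field. lra.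
  - intros z Hz Hzp. rewrite <- HAc. apply Haff; auto.
Qed.

Lemma horodisc_antitone (p z : C) (s t : R) :
  s <= t -> horodisc p t z -> horodisc p s z.
Proof.
  unfold horodisc. intros Hst H.
  assert (0 <= Cdot (Csub p z) (Csub p z)) by (unfold Cdot; nra). nra.
Qed.

(** The closed unit disc is [tau = 1 / 2], so on the excess [tau - 1 / 2] the map acts as x |-> A x
    + k; [k] measures how far the disc itself is pushed inwards. *)
Definition maps_horodiscs (p : C) (A k : R) (f : C -> C) : Prop :=
  forall tau z, 1 / 2 <= tau ->
    (exists u, horodisc p tau u /\ f u = z) <->
    horodisc p (1 / 2 + A * (tau - 1 / 2) + k) z.

(** In the coordinate, Re >= tau goes onto Re >= A tau + Re b. The point [p] has no coordinate and
    is treated apart: it is fixed and lies in every horodisc. *)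
Lemma mob_maps_horodiscs (m : Mob) (p : C) :
  Cnorm p = 1 -> in_MD m -> mob_eval m p = p ->
  0 < 1 / mob_deriv_norm m p /\
  exists k, 0 < k /\ maps_horodiscs p (1 / mob_deriv_norm m p) k (mob_eval m).
Proof.
  intros Hp Hm Hfix.
  destruct (mob_hcoord m p Hp Hm Hfix) as [A [b [HA [<- [Hb Hh]]]]].
  split; [exact HA|]. exists (A / 2 + fst b - 1 / 2). split; [lra|].
  intros tau z Ht.
  replace (1 / 2 + A * (tau - 1 / 2) + (A / 2 + fst b - 1 / 2)) with (A * tau + fst b) by field.
  assert (Hcl : forall u, horodisc p tau u -> Cnorm u <= 1).
  { intros u Hu. apply (horodisc_half p Hp). now apply (horodisc_antitone p u _ tau). }
  split.
  - intros [u [Hu <-]].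
    destruct (classic (u = p)) as [->|Hup]; [rewrite Hfix; apply horodisc_center|].
    destruct (Hh u (Hcl u Hu) Hup) as [H1 H2].
    apply (horodisc_hcoord p _ _ Hup) in Hu.
    apply (horodisc_hcoord p _ _ H1). rewrite H2.
    change (A * tau + fst b <= A * fst (hcoord p u) - 0 * snd (hcoord p u) + fst b). nra.
  - intros Hz.
    destruct (classic (z = p)) as [->|Hzp].
    { exists p. split; [apply horodisc_center|exact Hfix]. }
    apply (horodisc_hcoord p _ _ Hzp) in Hz.
    set (w := ((fst (hcoord p z) - fst b) / A, (snd (hcoord p z) - snd b) / A)).
    assert (Hw : tau <= fst w).
    { change (tau <= (fst (hcoord p z) - fst b) / A).
      apply (Rmult_le_reg_r A); [exact HA|]. unfold Rdiv.
      rewrite Rmult_assoc, Rinv_l, Rmult_1_r by lra. lra. }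
    assert (Hw0 : w <> C0).
    { intros H. apply (f_equal fst) in H. change (fst w = 0) in H. lra. }
    destruct (hcoord_inv p Hp w Hw0) as [H1 H2].
    assert (Hu : horodisc p tau (Csub p (Cdiv p w))).
    { apply (horodisc_hcoord p _ _ H1). now rewrite H2. }
    exists (Csub p (Cdiv p w)). split; [exact Hu|].
    destruct (Hh _ (Hcl _ Hu) H1) as [H3 H4].
    apply (hcoord_inj p Hp); auto. rewrite H4, H2. apply real_affine_solve. lra.
Qed.

(** * Nested images of the disc and the limit-disc criterion *)

(** The number T_n - 1/2: the map F_n sends the closed unit disc onto the horodisc of parameter
    [1 / 2 + offset l k w n]. *)
Fixpoint offset (l k : nat -> R) (w : nat -> nat) (n : nat) : R :=
  match n with
  | O => 0
  | S n' => offset l k w n' + exp (wsum l (prefix w n')) * k (w n')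
  end.

(** [compF] applies the last letter first, so the induction needs every [tau]: the new innermost map
    replaces [tau] by [tau']. *)
Lemma compF_horodisc (fam : nat -> Mob) (p : C) (l k : nat -> R) (w : nat -> nat) :
  (forall n, 0 < k (w n) /\ maps_horodiscs p (exp (l (w n))) (k (w n)) (mob_eval (fam (w n)))) ->
  forall n tau z, 1 / 2 <= tau ->
    (exists u, horodisc p tau u /\ compF fam w n u = z) <->
    horodisc p (1 / 2 + exp (wsum l (prefix w n)) * (tau - 1 / 2) + offset l k w n) z.
Proof.
  intros Hm n. induction n as [|n IH]; intros tau z Ht.
  - simpl. rewrite exp_0.
    replace (1 / 2 + 1 * (tau - 1 / 2) + 0) with tau by ring.
    split; [intros [u [Hu <-]]; exact Hu|intros H; now exists z].
  - rewrite prefix_S, wsum_snoc, exp_plus. simpl.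
    destruct (Hm n) as [Hk Hmap].
    set (tau' := 1 / 2 + exp (l (w n)) * (tau - 1 / 2) + k (w n)).
    pose proof (exp_pos (l (w n))) as He.
    assert (Ht' : 1 / 2 <= tau') by (unfold tau'; nra).
    replace (1 / 2 + exp (wsum l (prefix w n)) * exp (l (w n)) * (tau - 1 / 2) +
      (offset l k w n + exp (wsum l (prefix w n)) * k (w n)))
      with (1 / 2 + exp (wsum l (prefix w n)) * (tau' - 1 / 2) + offset l k w n)
      by (unfold tau'; ring).
    rewrite <- (IH tau' z Ht'). split.
    + intros [u [Hu Hz]]. exists (mob_eval (fam (w n)) u). split; [|exact Hz].
      apply (Hmap tau _ Ht). now exists u.
    + intros [u [Hu Hz]]. apply (Hmap tau _ Ht) in Hu. destruct Hu as [v [Hv <-]].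
      now exists v.
Qed.

(** The images are horodiscs at [p] with increasing parameters. A point other than [p] in all of
    them bounds the offsets by its coordinate; conversely, if the offsets converge to T, the
    intersection is the horodisc of parameter 1/2 + T. *)
Lemma limit_disc_iff (fam : nat -> Mob) (p : C) (l k : nat -> R) (w : nat -> nat) :
  Cnorm p = 1 ->
  (forall n, 0 < k (w n) /\ maps_horodiscs p (exp (l (w n))) (k (w n)) (mob_eval (fam (w n)))) ->
  limit_disc fam w <-> exists B, forall n, offset l k w n <= B.
Proof.
  intros Hp Hm.
  assert (Hdisc : forall n z, (exists u, Cnorm u <= 1 /\ compF fam w n u = z) <->
    horodisc p (1 / 2 + offset l k w n) z).
  { intros n z. pose proof (compF_horodisc fam p l k w Hm n (1 / 2) z (Rle_refl _)) as H.
    replace (1 / 2 + exp (wsum l (prefix w n)) * (1 / 2 - 1 / 2) + offset l k w n)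
      with (1 / 2 + offset l k w n) in H by ring.
    rewrite <- H. split; intros [u [Hu Hz]]; exists u; split; auto;
      now apply (horodisc_half p Hp). }
  assert (Hgrow : Un_growing (offset l k w)).
  { intros n. simpl. pose proof (exp_pos (wsum l (prefix w n))). destruct (Hm n). nra. }
  split.
  - intros [c [rho [Hrho Hlim]]].
    assert (Hz : exists z, z <> p /\ Cnorm (Csub z c) <= rho).
    { destruct (classic (c = p)) as [->|Hc].
      - exists (Cadd p (rho, 0)). split.
        + intros H. apply (f_equal fst) in H. unfold Cadd in H. simpl in H. lra.
        + apply Cnorm_le_iff; [lra|]. unfold Cdot, Csub, Cadd. simpl. nra.
      - exists c. split; [exact Hc|]. apply Cnorm_le_iff; [lra|].
        unfold Cdot, Csub. simpl. nra. }
    destruct Hz as [z [Hzp Hz]].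
    exists (fst (hcoord p z)). intros n.
    (* [limit_disc] speaks only of indices from 1 on, hence the shift to [S n]. *)
    apply Rle_trans with (offset l k w (S n)); [apply Hgrow|].
    assert (H : horodisc p (1 / 2 + offset l k w (S n)) z).
    { apply Hdisc, (proj2 (Hlim z) Hz). lia. }
    apply (horodisc_hcoord p _ _ Hzp) in H. lra.
  - intros [B HB].
    destruct (growing_cv _ Hgrow) as [T HT].
    { exists B. intros x [n ->]. apply HB. }
    assert (HnT : forall n, offset l k w n <= T) by (intros; now apply growing_ineq).
    assert (HT0 : 0 <= T) by apply (HnT 0%nat).
    exists (fst p * (1 - / (2 * (1 / 2 + T))), snd p * (1 - / (2 * (1 / 2 + T)))).
    exists (/ (2 * (1 / 2 + T))). split; [apply Rinv_0_lt_compat; lra|].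
    intros z. rewrite <- (horodisc_disc p Hp (1 / 2 + T) z) by lra. split.
    + intros H.
      destruct (classic (z = p)) as [->|Hzp]; [apply horodisc_center|].
      apply (horodisc_hcoord p _ _ Hzp).
      apply Rnot_lt_le. intros Hlt.
      destruct (HT (1 / 2 + T - fst (hcoord p z))) as [n Hn]; [lra|].
      specialize (Hn (S n) ltac:(lia)). unfold Rdist in Hn. apply Rabs_def2 in Hn.
      specialize (H (S n) ltac:(lia)). apply Hdisc in H.
      apply (horodisc_hcoord p _ _ Hzp) in H. lra.
    + intros H n _. apply Hdisc. apply (horodisc_antitone p z _ (1 / 2 + T)); auto.
      specialize (HnT n). lra.
Qed.

(** From index [M] on, every step adds at least [kmin]. *)
Lemma offset_unbounded (l k : nat -> R) (w : nat -> nat) (kmin : R) (M : nat) :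
  0 < kmin -> (forall n, kmin <= k (w n)) ->
  (forall n, (M <= n)%nat -> 0 <= wsum l (prefix w n)) ->
  forall B, exists n, B < offset l k w n.
Proof.
  intros Hk0 Hk HM B.
  assert (H : forall j, offset l k w M + INR j * kmin <= offset l k w (M + j)).
  { induction j as [|j IH].
    - rewrite Nat.add_0_r. simpl. lra.
    - rewrite S_INR. replace (M + S j)%nat with (S (M + j)) by lia.
      cbn [offset]. specialize (Hk (M + j)%nat).
      assert (1 <= exp (wsum l (prefix w (M + j)))).
      { rewrite <- exp_0. apply exp_le_compat, HM. lia. }
      nra. }
  destruct (INR_unbounded ((B - offset l k w M) / kmin)) as [j Hj].
  exists (M + j)%nat. apply Rlt_le_trans with (2 := H j).
  apply (Rmult_lt_compat_r kmin) in Hj; [|exact Hk0].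
  unfold Rdiv in Hj. rewrite Rmult_assoc, Rinv_l in Hj by lra. lra.
Qed.

(** Comparison with a geometric series of ratio exp (-e). *)
Lemma offset_bounded (l k : nat -> R) (w : nat -> nat) (kmax a e : R) :
  0 < e -> (forall n, 0 <= k (w n) <= kmax) ->
  (forall n, wsum l (prefix w n) <= a - e * INR n) ->
  exists B, forall n, offset l k w n <= B.
Proof.
  intros He Hk Hw. set (q := exp (- e)).
  assert (Hq : 0 < q < 1).
  { split; [apply exp_pos|]. rewrite <- exp_0. apply exp_increasing. lra. }
  exists (kmax * exp a * / (1 - q)).
  assert (Hi : 0 < / (1 - q)) by (apply Rinv_0_lt_compat; lra).
  assert (Hkm : 0 <= kmax) by (specialize (Hk 0%nat); lra).
  assert (H : forall n, offset l k w n <= kmax * exp a * ((1 - q ^ n) * / (1 - q))).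
  { induction n as [|n IH]; [simpl; lra|].
    cbn [offset].
    assert (exp (wsum l (prefix w n)) <= exp a * q ^ n).
    { assert (E : q ^ n = exp (- e * INR n)).
      { unfold q. clear. induction n as [|n IH]; [simpl; now rewrite Rmult_0_r, exp_0|].
        rewrite S_INR. simpl. rewrite IH, <- exp_plus. f_equal. ring. }
      rewrite E, <- exp_plus. apply exp_le_compat. specialize (Hw n). lra. }
    replace (kmax * exp a * ((1 - q ^ S n) * / (1 - q))) with
      (kmax * exp a * ((1 - q ^ n) * / (1 - q)) + exp a * q ^ n * kmax)
      by (simpl; field; lra).
    apply Rplus_le_compat; [exact IH|].
    apply Rmult_le_compat; [left; apply exp_pos|apply Hk|assumption|apply Hk]. }
  intros n. apply Rle_trans with (1 := H n).
  assert (0 <= q ^ n) by (apply pow_le; lra).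
  assert (0 <= kmax * exp a) by (apply Rmult_le_pos; [exact Hkm|left; apply exp_pos]).
  apply Rmult_le_compat_l; [assumption|].
  rewrite <- (Rmult_1_l (/ (1 - q))) at 2. apply Rmult_le_compat_r; lra.
Qed.

Lemma finite_pos_bounds (k : nat -> R) (N : nat) :
  (forall i, (i < N)%nat -> 0 < k i) ->
  exists kmin kmax, 0 < kmin /\ forall i, (i < N)%nat -> kmin <= k i <= kmax.
Proof.
  induction N as [|N IH]; intros H.
  - exists 1, 1. split; [lra|]. intros; lia.
  - destruct IH as [a [b [Ha Hab]]]; [intros; apply H; lia|].
    exists (Rmin a (k N)), (Rmax b (k N)).
    split; [apply Rmin_glb_lt; [exact Ha|apply H; lia]|].
    intros i Hi. destruct (Nat.eq_dec i N) as [->|].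
    + split; [apply Rmin_r|apply Rmax_r].
    + destruct (Hab i ltac:(lia)). split.
      * apply Rle_trans with a; [apply Rmin_l|assumption].
      * apply Rle_trans with b; [assumption|apply Rmax_l].
Qed.

(** * Families with complete tangency graph *)

(** The edges into [fam 0] give all maps the same alpha. The edges out of [fam 0] make every beta
    finite, so every map is tangent, and equal to that alpha, so each map fixes it. *)
Lemma common_fixed_point (N : nat) (fam : nat -> Mob) :
  (1 <= N)%nat ->
  (forall i j, (i < N)%nat -> (j < N)%nat -> Some (alpha (fam i)) = beta (fam j)) ->
  exists p, Cnorm p = 1 /\
    forall i, (i < N)%nat -> alpha (fam i) = p /\ mob_eval (fam i) p = p.
Proof.
  intros HN H. exists (alpha (fam 0%nat)).
  assert (Hb : forall j, (j < N)%nat ->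
    tangent (fam j) /\ alpha (fam 0%nat) = mob_eval (fam j) (alpha (fam j))).
  { intros j Hj. specialize (H 0%nat j ltac:(lia) Hj). unfold beta in H.
    destruct (excluded_middle_informative (tangent (fam j))) as [Ht|]; [|discriminate].
    injection H as H. auto. }
  assert (Ha : forall i, (i < N)%nat -> alpha (fam i) = alpha (fam 0%nat)).
  { intros i Hi. pose proof (H i 0%nat Hi ltac:(lia)) as H1.
    rewrite <- (H 0%nat 0%nat ltac:(lia) ltac:(lia)) in H1. now injection H1. }
  split.
  - destruct (Hb 0%nat ltac:(lia)) as [Ht _]. unfold alpha.
    destruct (excluded_middle_informative (tangent (fam 0%nat))); [|contradiction].
    apply (epsilon_spec (inhabits C0) (fun z => Cnorm z = 1 /\ Cnorm (mob_eval (fam 0%nat) z) = 1) Ht).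
  - intros i Hi. split; [now apply Ha|].
    destruct (Hb i Hi) as [_ H1]. now rewrite (Ha i Hi) in H1.
Qed.

(** What the dimension estimates use of the geometry: a necessary condition for the upper bound and
    a sufficient one for the lower bound. *)
Lemma limit_disc_drift (N : nat) (fam : nat -> Mob) :
  (1 <= N)%nat ->
  (forall i, (i < N)%nat -> in_MD (fam i)) ->
  (forall i j, (i < N)%nat -> (j < N)%nat -> Some (alpha (fam i)) = beta (fam j)) ->
  let l := fun d => ln (gamma (fam d)) in
  forall w, Omega N w ->
  (limit_disc fam w -> forall M, exists n, (M <= n)%nat /\ wsum l (prefix w n) < 0) /\
  (forall a e, 0 < e -> (forall n, wsum l (prefix w n) <= a - e * INR n) -> limit_disc fam w).
Proof.
  intros HN Hmd Hab l w Hw.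
  destruct (common_fixed_point N fam HN Hab) as [p [Hp Hfix]].
  assert (Hex : forall i, exists k, (i < N)%nat ->
    0 < k /\ maps_horodiscs p (exp (l i)) k (mob_eval (fam i))).
  { intros i. destruct (lt_dec i N) as [Hi|Hi]; [|exists 0; intros; lia].
    destruct (Hfix i Hi) as [Hai Hpi].
    destruct (mob_maps_horodiscs (fam i) p Hp (Hmd i Hi) Hpi) as [HA [k Hk]].
    exists k. intros _. unfold l, gamma. rewrite Hai, exp_ln by exact HA. exact Hk. }
  set (k := fun i => proj1_sig (constructive_indefinite_description _ (Hex i))).
  assert (Hk : forall i, (i < N)%nat ->
    0 < k i /\ maps_horodiscs p (exp (l i)) (k i) (mob_eval (fam i))).
  { intros i. apply (proj2_sig (constructive_indefinite_description _ (Hex i))). }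
  destruct (finite_pos_bounds k N) as [kmin [kmax [Hmin Hb]]]; [intros; now apply Hk|].
  assert (Hiff := limit_disc_iff fam p l k w Hp (fun n => Hk _ (Hw n))).
  split.
  - intros [B HB]%Hiff M. apply NNPP. intros Hno.
    destruct (offset_unbounded l k w kmin M Hmin) with (B := B) as [n Hn].
    + intros n. apply Hb, Hw.
    + intros n Hn. apply Rnot_lt_le. intros Hlt. apply Hno. now exists n.
    + specialize (HB n). lra.
  - intros a e He Hd. apply Hiff, (offset_bounded l k w kmax a e He); [|exact Hd].
    intros n. specialize (Hb (w n) (Hw n)). lra.
Qed.

(** * Upper bound *)

(* Bijective base-[N] numeration; [f] is fuel, enough as soon as [i <= f]. *)
Fixpoint word_of (N f i : nat) : list nat :=
  match f, i with
  | S f', S j => (j mod N)%nat :: word_of N f' (j / N)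
  | _, _ => []
  end.

Definition word (N i : nat) : list nat := word_of N i i.

Lemma word_of_fuel (N f i : nat) : (1 <= N)%nat -> (i <= f)%nat -> word_of N f i = word N i.
Proof.
  intros HN.
  assert (H : forall f i g, (i <= f)%nat -> (i <= g)%nat -> word_of N f i = word_of N g i).
  { intros f'. induction f' as [|f' IH]; intros i' g Hf Hg.
    - replace i' with 0%nat by lia. now destruct g.
    - destruct i' as [|i']; [now destruct g|]. destruct g as [|g]; [lia|].
      simpl. f_equal. assert (i' / N <= i')%nat by (apply Nat.Div0.div_le_upper_bound; nia).
      apply IH; lia. }
  intros Hf. now apply H.
Qed.

Lemma word_0 (N : nat) : word N 0 = [].
Proof. reflexivity. Qed.

Lemma word_S (N j d : nat) : (d < N)%nat -> word N (S (N * j + d)) = d :: word N j.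
Proof.
  intros Hd. unfold word at 1. cbn [word_of].
  replace ((N * j + d) mod N)%nat with d
    by (rewrite Nat.mul_comm, Nat.add_comm, Nat.Div0.mod_add, Nat.mod_small by lia; reflexivity).
  replace ((N * j + d) / N)%nat with j
    by (rewrite Nat.mul_comm, Nat.add_comm, Nat.div_add, Nat.div_small by lia; reflexivity).
  f_equal. apply word_of_fuel; nia.
Qed.

Lemma word_surj (N : nat) (v : list nat) :
  Forall (fun d => (d < N)%nat) v ->
  exists i, (length v <= i)%nat /\ word N i = v.
Proof.
  induction 1 as [|d v Hd Hv [j [Hj IH]]].
  - exists 0%nat. split; [simpl; lia|reflexivity].
  - exists (S (N * j + d)). split; [simpl; nia|]. rewrite word_S by exact Hd. now f_equal.
Qed.

(** In the numeration of words, index 0 is the empty word and block [j] consists of the one-letter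
    extensions [d :: word (S m) j]. *)
Lemma sum_f_R0_blocks (g : nat -> R) (m K : nat) :
  sum_f_R0 g (S m * S K) =
  g 0%nat + sum_f_R0 (fun j => sum_f_R0 (fun d => g (S (S m * j + d))) m) K.
Proof.
  assert (Hb : forall x r, sum_f_R0 g (x + S r) =
    sum_f_R0 g x + sum_f_R0 (fun d => g (S (x + d))) r).
  { intros x r. induction r as [|r IH].
    - rewrite Nat.add_1_r. simpl. now rewrite Nat.add_0_r.
    - replace (x + S (S r))%nat with (S (x + S r)) by lia. rewrite tech5, IH, tech5. ring. }
  induction K as [|K IH].
  - pose proof (Hb 0%nat m) as H0. simpl (0 + _)%nat in H0.
    rewrite Nat.mul_1_r, H0. cbn [sum_f_R0].
    f_equal. apply sum_eq. intros i _. f_equal. lia.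
  - replace (S m * S (S K))%nat with (S m * S K + S m)%nat by lia.
    rewrite Hb, IH, tech5. ring.
Qed.

(** For multiplicative [g] the words of length n contribute q^n. On partial sums, splitting off the
    first letter gives G(K) <= 1 + q G(K). *)
Lemma word_sum_bounded (m : nat) (h : nat -> R) (g : list nat -> R) (q : R) :
  g [] = 1 -> (forall d v, (d <= m)%nat -> g (d :: v) = h d * g v) ->
  (forall v, 0 <= g v) -> sum_f_R0 h m = q -> q < 1 ->
  forall K, sum_f_R0 (fun i => g (word (S m) i)) K <= / (1 - q).
Proof.
  intros Hnil Hcons Hg Hq Hq1 K.
  set (G := sum_f_R0 (fun i => g (word (S m) i))).
  assert (HG : G K <= G (S m * S K)%nat) by (apply sum_f_R0_incr; [intros; apply Hg|nia]).
  assert (E : G (S m * S K)%nat = 1 + q * G K).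
  { unfold G. rewrite sum_f_R0_blocks, word_0, Hnil. f_equal.
    rewrite <- sum_f_R0_scal_l. apply sum_eq. intros j _.
    rewrite <- Hq, Rmult_comm, scal_sum. apply sum_eq. intros d Hd.
    rewrite word_S by lia. apply Hcons, Hd. }
  apply (Rmult_le_reg_r (1 - q)); [lra|]. rewrite Rinv_l by lra.
  change (G K * (1 - q) <= 1). lra.
Qed.

Lemma series_tail (g : nat -> R) (B eps : R) :
  (forall i, 0 <= g i) -> (forall n, sum_f_R0 g n <= B) -> 0 < eps ->
  exists I, forall K, sum_f_R0 (fun i => if le_dec i I then 0 else g i) K <= eps.
Proof.
  intros Hg HB He.
  destruct (infinite_sum_bounded g B Hg HB) as [T [HT [_ HnT]]].
  destruct (HT eps He) as [I HI]. exists I.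
  specialize (HI I (le_n I)). unfold Rdist in HI. apply Rabs_def2 in HI.
  assert (H0 : forall K, (K <= I)%nat -> sum_f_R0 (fun i => if le_dec i I then 0 else g i) K = 0).
  { induction K as [|K IH]; intros HK; simpl; [destruct (le_dec 0 I); [reflexivity|lia]|].
    rewrite IH by lia. destruct (le_dec (S K) I); [ring|lia]. }
  intros K. destruct (le_dec K I) as [HK|HK]; [rewrite H0 by exact HK; lra|].
  apply Rle_trans with (sum_f_R0 g K - sum_f_R0 g I); [|specialize (HnT K); lra].
  right. assert (HIK : (I <= K)%nat) by lia. clear HK. induction HIK as [|K HIK IH].
  - rewrite H0 by lia. ring.
  - simpl. rewrite IH. destruct (le_dec (S K) I); [lia|ring].
Qed.

Lemma exp_ln_pow (N n : nat) : (1 <= N)%nat -> INR N ^ n = exp (INR n * ln (INR N)).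
Proof.
  intros HN. assert (0 < INR N) by (apply lt_0_INR; lia).
  induction n as [|n IH]; [simpl; now rewrite Rmult_0_l, exp_0|].
  rewrite S_INR, Rmult_plus_distr_r, exp_plus, Rmult_1_l, exp_ln by assumption.
  simpl. rewrite IH. ring.
Qed.

Lemma hpow_cylinder (N n : nat) (t : R) : (1 <= N)%nat ->
  hpow (/ INR N ^ n) t = exp (- t * (INR n * ln (INR N))).
Proof.
  intros HN. assert (0 < INR N) by (apply lt_0_INR; lia).
  assert (Hp : 0 < INR N ^ n) by now apply pow_lt.
  unfold hpow. destruct (Rlt_dec 0 (/ INR N ^ n)) as [_|Hn].
  - unfold Rpower. f_equal. rewrite ln_Rinv by assumption.
    rewrite (exp_ln_pow N n HN), ln_exp. ring.
  - exfalso. apply Hn. now apply Rinv_0_lt_compat.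
Qed.

Lemma inv_pow_small (N : nat) (delta : R) : (2 <= N)%nat -> 0 < delta ->
  exists M, / INR N ^ M <= delta.
Proof.
  intros HN Hd.
  assert (H1 : 1 < INR N) by (apply (lt_INR 1); lia).
  destruct (Pow_x_infinity (INR N)) with (b := / delta) as [M HM].
  { rewrite Rabs_pos_eq; lra. }
  exists M. specialize (HM M (le_n M)).
  rewrite Rabs_pos_eq in HM by (apply pow_le; lra).
  rewrite <- (Rinv_inv delta). apply Rinv_le_contravar; [now apply Rinv_0_lt_compat|lra].
Qed.

(** [E] is covered by the cylinders of arbitrarily long words with negative [wsum]. For these, exp
    (-s [wsum]) >= 1 bounds the cost by the multiplicative weight [g], which is summable because its
    one-letter sum exp (P(s) - t log N) is below 1. *)
Lemma Hnull_upper (m : nat) (l : nat -> R) (E : (nat -> nat) -> Prop) (s t : R) :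
  (1 <= m)%nat -> 0 <= s -> 0 <= t ->
  pressure m l s < t * ln (INR (S m)) ->
  (forall w, E w -> Omega (S m) w /\
     forall M, exists n, (M <= n)%nat /\ wsum l (prefix w n) < 0) ->
  Hnull (S m) t E.
Proof.
  intros Hm Hs Ht Hpr HE delta eps Hdelta Heps.
  set (N := S m) in *. set (lN := ln (INR N)) in *.
  assert (HN1 : 1 < INR N) by (apply (lt_INR 1); unfold N; lia).
  assert (HlN : 0 < lN) by (unfold lN; rewrite <- ln_1; apply ln_increasing; lra).
  set (g := fun v => exp (- t * (INR (length v) * lN) - s * wsum l v)).
  assert (Hg : forall v, 0 <= g v) by (intros; left; apply exp_pos).
  destruct (series_tail (fun i => g (word N i))
    (/ (1 - exp (pressure m l s - t * lN))) eps) as [I HI]; [intros; apply Hg| |exact Heps|].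
  { apply (word_sum_bounded m (fun d => exp (- t * lN) * exp (- s * l d)) g); auto.
    - unfold g. simpl. rewrite <- exp_0. f_equal. ring.
    - intros d v _. unfold g. rewrite <- !exp_plus. f_equal.
      cbn [length wsum fold_right]. fold (wsum l v). rewrite S_INR. ring.
    - rewrite sum_f_R0_scal_l. fold (psum m l s). rewrite <- exp_pressure, <- exp_plus.
      f_equal. ring.
    - rewrite <- exp_0. apply exp_increasing. lra. }
  destruct (inv_pow_small N delta) as [M HM]; [unfold N; lia|exact Hdelta|].
  (* [I < i] keeps the total cost below [eps], and the length bound [M] keeps the diameters below
     [delta]. *)
  set (U := fun i (x : nat -> nat) =>
    (I < i)%nat /\ (M <= length (word N i))%nat /\ wsum l (word N i) < 0 /\
    prefix x (length (word N i)) = word N i).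
  (* Sequences sharing n letters first differ at place n + 1 or later, counted from 1. *)
  set (r := fun i => / INR N ^ S (length (word N i))).
  set (c := fun i => if excluded_middle_informative (exists x, U i x) then hpow (r i) t else 0).
  exists U, r, c.
  assert (Hpow : forall a b, (a <= b)%nat -> / INR N ^ b <= / INR N ^ a).
  { intros a b Hab. apply Rinv_le_contravar; [apply pow_lt; lra|].
    apply Rle_pow; [lra|exact Hab]. }
  assert (Hc : forall i, 0 <= c i <= if le_dec i I then 0 else g (word N i)).
  { intros i. unfold c. destruct (excluded_middle_informative _) as [[x [Hi [_ [Hneg _]]]]|_].
    - unfold r. rewrite hpow_cylinder by (unfold N; lia). fold lN.
      destruct (le_dec i I); [lia|]. split; [left; apply exp_pos|].
      apply exp_le_compat. rewrite S_INR. nra.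
    - destruct (le_dec i I); [lra|]. split; [lra|apply Hg]. }
  split; [|split].
  - intros i. split.
    + intros [x0 Hx0]. split; [|split].
      * split; [left; apply Rinv_0_lt_compat, pow_lt; lra|].
        destruct Hx0 as [_ [HMi _]]. apply Rle_trans with (2 := HM). apply Hpow. lia.
      * intros x y [_ [_ [_ Hx]]] [_ [_ [_ Hy]]] k Heq Hne. apply Hpow.
        rewrite <- Hy in Hx at 2. rewrite prefix_ext in Hx.
        destruct (le_lt_dec (length (word N i)) k) as [|Hlt]; [lia|].
        now elim (Hne (Hx k Hlt)).
      * unfold c. destruct (excluded_middle_informative _) as [_|Hn]; [reflexivity|].
        elim Hn. now exists x0.
    + intros Hn. unfold c. destruct (excluded_middle_informative _); [contradiction|reflexivity].
  - intros w Hw. destruct (HE w Hw) as [HO Hinf].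
    (* The index of a word is at least its length, so a prefix longer than [I] has index beyond
       [I]. *)
    destruct (Hinf (S (Nat.max I M))) as [n [Hn Hneg]].
    destruct (word_surj N (prefix w n)) as [i [Hi Hwi]]; [now apply prefix_Forall|].
    rewrite length_prefix in Hi.
    exists i. unfold U. rewrite Hwi, length_prefix. repeat split; auto; lia.
  - destruct (infinite_sum_bounded c eps) as [T [HT [HTe _]]].
    + intros i. apply Hc.
    + intros n. apply Rle_trans with (2 := HI n). apply sum_Rle. intros i _. apply Hc.
    + now exists T.
Qed.

(** * Lower bound *)

(* Averaging over the last letter does not increase [W K], so some letter keeps all the [W K] below [b] at once: otherwise one [K] would violate this for every letter. *)
Lemma greedy_path (m : nat) (p : nat -> R) (W : nat -> list nat -> R) (b : R) :
  (forall d, 0 < p d) -> sum_f_R0 p m = 1 ->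
  (forall K v, W K v <= W (S K) v) ->
  (forall K v, sum_f_R0 (fun d => p d * W K (v ++ [d])) m <= W K v) ->
  (forall K, W K [] <= b) ->
  exists w, (forall n, (w n <= m)%nat) /\ forall n K, W K (prefix w n) <= b.
Proof.
  intros Hp Hp1 Hmon Havg H0.
  assert (Hmon' : forall v K K', (K <= K')%nat -> W K v <= W K' v).
  { intros v K K' H. induction H as [|K' _ IH]; [lra|]. specialize (Hmon K' v). lra. }
  assert (Hstep : forall v, exists d, (forall K, W K v <= b) ->
    (d <= m)%nat /\ forall K, W K (v ++ [d]) <= b).
  { intros v. destruct (classic (forall K, W K v <= b)) as [Hv|Hv];
      [|exists 0%nat; intros; contradiction].
    apply NNPP. intros Hno.
    assert (Hbad : forall d, (d <= m)%nat -> exists K, b < W K (v ++ [d])).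
    { intros d Hd. apply NNPP. intros Hn. apply Hno. exists d. intros _. split; [exact Hd|].
      intros K. apply Rnot_lt_le. intros Hlt. apply Hn. now exists K. }
    assert (Hall : forall j, (j <= m)%nat ->
      exists K, forall d, (d <= j)%nat -> b < W K (v ++ [d])).
    { induction j as [|j IH]; intros Hj.
      - destruct (Hbad 0%nat Hj) as [K HK]. exists K. intros d Hd.
        now replace d with 0%nat by lia.
      - destruct IH as [K HK]; [lia|]. destruct (Hbad (S j) Hj) as [K' HK'].
        exists (Nat.max K K'). intros d Hd. destruct (Nat.eq_dec d (S j)) as [->|].
        + apply Rlt_le_trans with (1 := HK'), Hmon'; lia.
        + apply Rlt_le_trans with (W K (v ++ [d])); [apply HK; lia|apply Hmon'; lia]. }
    destruct (Hall m (le_n m)) as [K HK].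
    assert (Hlt : sum_f_R0 (fun d => p d * b) m < sum_f_R0 (fun d => p d * W K (v ++ [d])) m).
    { apply (sum_f_R0_lt _ _ m 0); [|lia|].
      - intros d Hd. apply Rmult_le_compat_l; [left; apply Hp|left; now apply HK].
      - apply Rmult_lt_compat_l; [apply Hp|apply HK; lia]. }
    rewrite <- scal_sum, Hp1 in Hlt. specialize (Havg K v). specialize (Hv K). lra. }
  set (next := fun v => proj1_sig (constructive_indefinite_description _ (Hstep v))).
  assert (Hnext : forall v, (forall K, W K v <= b) ->
    (next v <= m)%nat /\ forall K, W K (v ++ [next v]) <= b).
  { intros v. apply (proj2_sig (constructive_indefinite_description _ (Hstep v))). }
  set (st := fix st n := match n with O => [] | S n' => st n' ++ [next (st n')] end).
  set (w := fun n => next (st n)).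
  assert (Hst : forall n, prefix w n = st n).
  { induction n as [|n IH]; [reflexivity|]. rewrite prefix_S, IH. reflexivity. }
  assert (Hinv : forall n K, W K (st n) <= b).
  { induction n as [|n IH]; [exact H0|]. now apply Hnext. }
  exists w. split.
  - intros n. now apply Hnext.
  - intros n. rewrite Hst. apply Hinv.
Qed.

(* Conditional mass of the cylinder [u] given the cylinder [v], for the product measure with cylinder masses [mu]. *)
Fixpoint cmass (mu : list nat -> R) (u v : list nat) : R :=
  match u, v with
  | [], _ => 1
  | _, [] => mu u
  | a :: u', b :: v' => if Nat.eq_dec a b then cmass mu u' v' else 0
  end.

Lemma cmass_self (mu : list nat -> R) (u : list nat) : cmass mu u u = 1.
Proof. induction u as [|a u IH]; simpl; [reflexivity|]. now destruct (Nat.eq_dec a a). Qed.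

Lemma cmass_nonneg (mu : list nat -> R) (u v : list nat) :
  (forall x, 0 <= mu x) -> 0 <= cmass mu u v.
Proof.
  intros Hmu. revert v. induction u as [|a u IH]; intros [|b v]; simpl; try lra; auto.
  destruct (Nat.eq_dec a b); [apply IH|lra].
Qed.

(** The martingale property of conditional mass, by induction along the common part of [u] and
    [v]. *)
Lemma cmass_average (m : nat) (p : nat -> R) (mu : list nat -> R) (u v : list nat) :
  sum_f_R0 p m = 1 -> mu [] = 1 -> (forall a x, mu (a :: x) = p a * mu x) ->
  Forall (fun d => (d <= m)%nat) u ->
  sum_f_R0 (fun d => p d * cmass mu u (v ++ [d])) m = cmass mu u v.
Proof.
  intros Hp1 Hnil Hcons Hu. revert v.
  assert (H1 : sum_f_R0 (fun d => p d * 1) m = 1).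
  { rewrite <- Hp1 at 1. apply sum_eq. intros; ring. }
  induction Hu as [|a u Ha Hu IH]; intros v; [destruct v; exact H1|].
  destruct v as [|b v]; simpl.
  - rewrite Hcons, <- (sum_f_R0_indicator (fun d => p d * mu u) m a Ha).
    apply sum_eq. intros d _. destruct (Nat.eq_dec a d); [|ring].
    destruct u; simpl; [now rewrite Hnil|reflexivity].
  - destruct (Nat.eq_dec a b); [apply IH|].
    rewrite sum_eq_R0; [reflexivity|]. intros; ring.
Qed.

Definition bernoulli (m : nat) (l : nat -> R) (s : R) (d : nat) : R :=
  exp (- s * l d - pressure m l s).

Lemma bernoulli_sum (m : nat) (l : nat -> R) (s : R) : sum_f_R0 (bernoulli m l s) m = 1.
Proof.
  rewrite (sum_eq _ (fun d => exp (- pressure m l s) * exp (- s * l d))).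
  - rewrite sum_f_R0_scal_l. fold (psum m l s). rewrite <- exp_pressure, <- exp_plus.
    rewrite Rplus_opp_l. apply exp_0.
  - intros d _. unfold bernoulli. rewrite <- exp_plus. f_equal. ring.
Qed.

Definition bmass (m : nat) (l : nat -> R) (s : R) (v : list nat) : R :=
  exp (- s * wsum l v - INR (length v) * pressure m l s).

(* The density of the Bernoulli measure at [s - x] with respect to the one at [s]. *)
Definition tilt (m : nat) (l : nat -> R) (s x : R) (v : list nat) : R :=
  exp (x * wsum l v + INR (length v) * (pressure m l s - pressure m l (s - x))).

(** The martingale property of a likelihood ratio: the weights at [s] times the one-letter density
    are the weights at [s - x], which sum to 1. *)
Lemma tilt_average (m : nat) (l : nat -> R) (s x : R) (v : list nat) :
  sum_f_R0 (fun d => bernoulli m l s d * tilt m l s x (v ++ [d])) m = tilt m l s x v.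
Proof.
  rewrite (sum_eq _ (fun d => tilt m l s x v * bernoulli m l (s - x) d)).
  - rewrite sum_f_R0_scal_l, bernoulli_sum. ring.
  - intros d _. unfold tilt, bernoulli. rewrite <- !exp_plus, wsum_snoc, length_snoc, S_INR.
    f_equal. ring.
Qed.

(** A first disagreement at a position i < n would put the sequences at distance N^{-(i+1)} >=
    N^{-n} > r. *)
Lemma dist_le_agree (N : nat) (x y : nat -> nat) (r : R) (n : nat) :
  (2 <= N)%nat -> dist_le N x y r -> r < / INR N ^ n -> forall i, (i < n)%nat -> x i = y i.
Proof.
  intros HN Hd Hr i. induction i as [i IH] using lt_wf_ind. intros Hi.
  apply NNPP. intros Hne.
  assert (H1 : 1 < INR N) by (apply (lt_INR 1); lia).
  assert (H : / INR N ^ S i <= r) by (apply Hd; [intros; apply IH; lia|exact Hne]).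
  assert (/ INR N ^ n <= / INR N ^ S i).
  { apply Rinv_le_contravar; [apply pow_lt; lra|]. apply Rle_pow; [lra|lia]. }
  lra.
Qed.

Lemma cylinder_scale (N : nat) (r : R) : (2 <= N)%nat -> 0 < r < 1 ->
  exists n, / INR N ^ S n <= r < / INR N ^ n.
Proof.
  intros HN Hr. destruct (inv_pow_small N r HN) as [M HM]; [lra|].
  induction M as [|M IH].
  - simpl in HM. rewrite Rinv_1 in HM. lra.
  - destruct (Rle_lt_dec (/ INR N ^ M) r); [now apply IH|now exists M].
Qed.

Lemma exp_neg_small (k e : R) : 0 < k -> 0 < e -> exists n, exp (- k * INR n) <= e.
Proof.
  intros Hk He. destruct (INR_unbounded (- ln e / k)) as [n Hn]. exists n.
  rewrite <- (exp_ln e He). apply exp_le_compat.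
  apply (Rmult_lt_compat_r k) in Hn; [|exact Hk].
  unfold Rdiv in Hn. rewrite Rmult_assoc, Rinv_l in Hn by lra. lra.
Qed.

Lemma sum_half_pow (K : nat) : sum_f_R0 (fun i => (/ 2) ^ S i) K <= 1.
Proof.
  assert (E : sum_f_R0 (fun i => (/ 2) ^ S i) K = 1 - (/ 2) ^ S K).
  { induction K as [|K IH]; [simpl; lra|]. rewrite tech5, IH. simpl. lra. }
  rewrite E. assert (0 <= (/ 2) ^ S K) by (apply pow_le; lra). lra.
Qed.

(* A cover of small [t]-content can be replaced by one with cylinders; the term [e] takes care of sets of diameter [0]. *)
Lemma cover_by_cylinder (m : nat) (U : (nat -> nat) -> Prop) (r c t k e : R) :
  (1 <= m)%nat -> 0 <= t -> t * ln (INR (S m)) < k -> 0 < e ->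
  ((exists x, U x) -> 0 <= r <= / 2 /\
     (forall x y, U x -> U y -> dist_le (S m) x y r) /\ c = hpow r t) ->
  (~ (exists x, U x) -> c = 0) ->
  0 <= c /\
  exists u, Forall (fun d => (d <= m)%nat) u /\
    (forall w, U w -> Omega (S m) w -> prefix w (length u) = u) /\
    exp (- k * INR (length u)) <= exp (t * ln (INR (S m))) * (c + e).
Proof.
  intros Hm Ht Hk He HU HnU.
  assert (HN1 : 1 < INR (S m)) by (apply (lt_INR 1); lia).
  assert (HlN : 0 < ln (INR (S m))) by (rewrite <- ln_1; apply ln_increasing; lra).
  assert (Htl : 0 <= t * ln (INR (S m))) by (apply Rmult_le_pos; lra).
  assert (Hexp : 1 <= exp (t * ln (INR (S m)))).
  { rewrite <- exp_0. now apply exp_le_compat. }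
  assert (Hc : 0 <= c).
  { destruct (classic (exists x, U x)) as [Hx|Hx]; [|rewrite (HnU Hx); lra].
    destruct (HU Hx) as [_ [_ ->]]. unfold hpow, Rpower.
    destruct (Rlt_dec 0 r); [left; apply exp_pos|]. destruct (Req_EM_T t 0); lra. }
  split; [exact Hc|].
  destruct (exp_neg_small k e) as [n0 Hn0]; [lra|exact He|].
  assert (Hn0' : exp (- k * INR n0) <= exp (t * ln (INR (S m))) * (c + e)) by nra.
  assert (Hpre : forall x n, Omega (S m) x -> Forall (fun d => (d <= m)%nat) (prefix x n)).
  { intros x n Hx. apply prefix_Forall. intros i. specialize (Hx i). lia. }
  destruct (classic (exists x, U x /\ Omega (S m) x)) as [[x [Hx HxO]]|Hno].
  - destruct (HU (ex_intro _ x Hx)) as [Hr [Hd Hcr]].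
    destruct (Req_dec r 0) as [Hr0|Hr0].
    + exists (prefix x n0). rewrite length_prefix. split; [now apply Hpre|]. split; [|exact Hn0'].
      intros w Hw _. apply prefix_ext. apply (dist_le_agree (S m) w x r); [lia|now apply Hd|].
      rewrite Hr0. apply Rinv_0_lt_compat, pow_lt. lra.
    + destruct (cylinder_scale (S m) r) as [n [Hn1 Hn2]]; [lia|lra|].
      exists (prefix x n). rewrite length_prefix. split; [now apply Hpre|]. split.
      * intros w Hw _. apply prefix_ext. apply (dist_le_agree (S m) w x r); [lia|now apply Hd|exact Hn2].
      * apply Rle_trans with (exp (t * ln (INR (S m))) * c);
          [|apply Rmult_le_compat_l; lra].
        rewrite Hcr. unfold hpow. destruct (Rlt_dec 0 r) as [Hrp|]; [|lra].
        unfold Rpower. rewrite <- exp_plus. apply exp_le_compat.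
        (* The scale is known only up to one factor [S m]; this is the origin of the constant exp (t
           log ([S m])) in the conclusion. *)
        assert (Hln : - (INR (S n) * ln (INR (S m))) <= ln r).
        { rewrite <- (ln_exp (INR (S n) * ln (INR (S m)))), <- exp_ln_pow by lia.
          rewrite <- ln_Rinv by (apply pow_lt; lra).
          apply ln_le_compat; [apply Rinv_0_lt_compat, pow_lt; lra|exact Hn1]. }
        rewrite S_INR in Hln. pose proof (pos_INR n).
        apply (Rmult_le_compat_l t) in Hln; [|exact Ht].
        assert (t * ln (INR (S m)) * INR n <= k * INR n) by (apply Rmult_le_compat_r; lra).
        lra.
  (* [U] has no sequence over the alphabet, so any long enough word serves. *)
  - exists (prefix (fun _ => 0%nat) n0). rewrite length_prefix. split; [|split; [|exact Hn0']].
    + apply prefix_Forall. intros; lia.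
    + intros w Hw HwO. elim Hno. now exists w.
Qed.

Lemma continuity_pos_right (g : R -> R) (x : R) :
  continuity_pt g x -> 0 < g x -> exists y, x < y /\ 0 < g y.
Proof.
  intros Hg Hx. destruct (Hg (g x) Hx) as [a [Ha Hy]].
  exists (x + a / 2). split; [lra|].
  assert (H : Rabs (g (x + a / 2) - g x) < g x).
  { apply (Hy (x + a / 2)). split.
    - split; [exact I|lra].
    - simpl. unfold Rdist. rewrite Rabs_pos_eq; lra. }
  apply Rabs_def2 in H. lra.
Qed.

Lemma Hnull_lower (m j : nat) (l : nat -> R) (E : (nat -> nat) -> Prop) (s0 t : R) :
  (1 <= m)%nat -> (j <= m)%nat -> l j < 0 -> 0 <= s0 -> 0 <= t ->
  (forall s, 0 <= s -> pressure m l s0 <= pressure m l s) ->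
  (forall w a e, Omega (S m) w -> 0 < e ->
     (forall n, wsum l (prefix w n) <= a - e * INR n) -> E w) ->
  Hnull (S m) t E -> pressure m l s0 <= t * ln (INR (S m)).
Proof.
  intros Hm Hj Hlj Hs0 Ht Hmin HE HH.
  apply Rnot_lt_le. intros Hlt.
  set (f := pressure m l) in *. set (T := t * ln (INR (S m))) in *.
  (* [h] makes the mass exponent f(s) - (s/h)(f(s+h) - f(s)) exceed [T] at [s0]. By continuity this
     persists at some [s > s0], where moreover f(s0) < f(s). *)
  destruct (pressure_min_slope m l s0 (f s0 - T)) as [h [Hh Hslope]]; auto; [lra|].
  fold f in Hslope.
  destruct (continuity_pos_right (fun s => f s - s / h * (f (s + h) - f s) - T) s0)
    as [s [Hs HG]]; [|lra|].
  { assert (Hf : continuity f) by apply pressure_continuity.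
    apply (continuity_pt_minus (fun s => f s - s / h * (f (s + h) - f s)) (fun _ => T));
      [|now apply continuity_const].
    apply (continuity_pt_minus f (fun s => s / h * (f (s + h) - f s))); [apply Hf|].
    apply (continuity_pt_mult (fun s => s / h) (fun s => f (s + h) - f s)); [reg|].
    apply (continuity_pt_minus (fun s => f (s + h)) f); [|apply Hf].
    apply (continuity_pt_comp (fun s => s + h) f); [reg|apply Hf]. }
  assert (Hfs : f s0 < f s) by (apply (pressure_min_strict m j l); auto).
  set (k := f s - s / h * (f (s + h) - f s)) in *.
  set (A := exp (s / h * ln 4)). set (NT := exp T).
  assert (HA : 0 < A) by apply exp_pos. assert (HNT : 0 < NT) by apply exp_pos.
  (* Content [e0] for the cover and another [e0] for the error terms of the cylinders give total
     mass at most [A * NT * (2 * e0)], which is 1/4. Diameters at most 1/2 are below 1, as the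
     passage to cylinders requires. *)
  set (e0 := / (8 * (A * NT))).
  assert (He0 : 0 < e0) by (apply Rinv_0_lt_compat; nra).
  destruct (HH (/ 2) e0) as [U [r [c [HU [Hcov [T0 [HT0 HT0e]]]]]]]; [lra|exact He0|].
  assert (Hcyl : forall i, 0 <= c i /\
    exists u, Forall (fun d => (d <= m)%nat) u /\
    (forall w, U i w -> Omega (S m) w -> prefix w (length u) = u) /\
    exp (- k * INR (length u)) <= NT * (c i + e0 * (/ 2) ^ S i)).
  { intros i. destruct (HU i) as [H1 H2].
    apply (cover_by_cylinder m (U i) (r i)); auto; [fold T; lra|].
    apply Rmult_lt_0_compat; [exact He0|]. apply pow_lt. lra. }
  assert (Hc : forall i, 0 <= c i) by (intros i; apply Hcyl).
  set (u := fun i => proj1_sig (constructive_indefinite_description _ (proj2 (Hcyl i)))).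
  assert (Hu : forall i, Forall (fun d => (d <= m)%nat) (u i) /\
    (forall w, U i w -> Omega (S m) w -> prefix w (length (u i)) = u i) /\
    exp (- k * INR (length (u i))) <= NT * (c i + e0 * (/ 2) ^ S i)).
  { intros i. apply (proj2_sig (constructive_indefinite_description _ (proj2 (Hcyl i)))). }
  clearbody u.
  (* Only cylinders with a small likelihood ratio have mass controlled by exp (-k n). The others get
     weight 0, since the path avoids them by keeping the ratio itself bounded. *)
  set (act := fun i => if Rle_dec (tilt m l s (- h) (u i)) 4 then 1 else 0).
  assert (Hact : forall i, 0 <= act i) by (intros i; unfold act; destruct (Rle_dec _ _); lra).
  assert (Hmass : forall i, act i * bmass m l s (u i) <= A * NT * (c i + e0 * (/ 2) ^ S i)).
  { intros i. destruct (Hu i) as [_ [_ Hk]]. unfold act.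
    destruct (Rle_dec (tilt m l s (- h) (u i)) 4) as [Hgood|_].
    - rewrite Rmult_1_l, Rmult_assoc.
      apply Rle_trans with (A * exp (- k * INR (length (u i))));
        [|apply Rmult_le_compat_l; [lra|exact Hk]].
      unfold A, bmass. rewrite <- exp_plus. apply exp_le_compat. fold (f s).
      unfold tilt in Hgood. apply ln_le_compat in Hgood; [|apply exp_pos].
      rewrite ln_exp in Hgood.
      replace (s - - h) with (s + h) in Hgood by ring. fold f in Hgood.
      apply (Rmult_le_compat_l (s / h)) in Hgood;
        [|apply Rmult_le_pos; [lra|left; now apply Rinv_0_lt_compat]].
      replace (- s * wsum l (u i)) with (s / h * (- h * wsum l (u i))) by (field; lra).
      unfold k. nra.
    - rewrite Rmult_0_l. apply Rmult_le_pos; [nra|].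
      assert (0 < (/ 2) ^ S i) by (apply pow_lt; lra). specialize (Hc i). nra. }
  (* [V] is 1/4 at the empty word, which with mass 1/4 for the cover gives the initial bound 1/2;
     keeping that bound forces each ratio to stay at most 4. *)
  set (V := fun v => / 8 * tilt m l s (s - s0) v + / 8 * tilt m l s (- h) v).
  set (W := fun K v => sum_f_R0 (fun i => act i * cmass (bmass m l s) (u i) v) K + V v).
  assert (Htilt : forall x v, 0 < tilt m l s x v) by (intros; apply exp_pos).
  assert (Hbm : forall v, 0 <= bmass m l s v) by (intros; left; apply exp_pos).
  destruct (greedy_path m (bernoulli m l s) W (/ 2)) as [w [Hwm HW]].
  - intros d. apply exp_pos.
  - apply bernoulli_sum.
  - intros K v. unfold W. rewrite tech5.
    assert (0 <= act (S K) * cmass (bmass m l s) (u (S K)) v); [|lra].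
    apply Rmult_le_pos; [apply Hact|]. now apply cmass_nonneg.
  - intros K v. right. unfold W, V.
    rewrite (sum_eq _ (fun d =>
      sum_f_R0 (fun i => bernoulli m l s d * (act i * cmass (bmass m l s) (u i) (v ++ [d]))) K +
      (/ 8 * (bernoulli m l s d * tilt m l s (s - s0) (v ++ [d])) +
       / 8 * (bernoulli m l s d * tilt m l s (- h) (v ++ [d]))))).
    + rewrite !plus_sum, !sum_f_R0_scal_l, !tilt_average, sum_f_R0_swap. f_equal.
      apply sum_eq. intros i _.
      rewrite <- (cmass_average m (bernoulli m l s) (bmass m l s) (u i) v).
      * rewrite <- sum_f_R0_scal_l. apply sum_eq. intros; ring.
      * apply bernoulli_sum.
      * unfold bmass. simpl. rewrite <- exp_0. f_equal. ring.
      * intros a x. unfold bmass, bernoulli. rewrite <- exp_plus. f_equal.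
        cbn [length wsum fold_right]. fold (wsum l x). rewrite S_INR. ring.
      * apply Hu.
    + intros d _. rewrite sum_f_R0_scal_l. ring.
  - intros K. unfold W, V, tilt. simpl wsum. simpl length. simpl INR.
    rewrite !Rmult_0_l, !Rmult_0_r, !Rplus_0_r, exp_0.
    assert (H : sum_f_R0 (fun i => act i * cmass (bmass m l s) (u i) []) K <= / 4); [|lra].
    apply Rle_trans with (sum_f_R0 (fun i => A * NT * (c i + e0 * (/ 2) ^ S i)) K).
    + apply sum_Rle. intros i _. apply Rle_trans with (2 := Hmass i). right. f_equal.
      destruct (u i); [|reflexivity]. unfold bmass. simpl. rewrite <- exp_0. f_equal. ring.
    + rewrite sum_f_R0_scal_l, plus_sum, sum_f_R0_scal_l.
      pose proof (sum_half_pow K).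
      pose proof (infinite_sum_partial_le c T0 K Hc HT0).
      apply Rle_trans with (A * NT * (2 * e0)).
      * apply Rmult_le_compat_l; [nra|]. nra.
      * right. unfold e0. field. split; lra.
  - assert (HwO : Omega (S m) w) by (intros n; specialize (Hwm n); lia).
    assert (Hsum : forall n K, 0 <= sum_f_R0 (fun i => act i * cmass (bmass m l s) (u i) (prefix w n)) K).
    { intros n K. apply sum_f_R0_nonneg. intros i _.
      apply Rmult_le_pos; [apply Hact|]. now apply cmass_nonneg. }
    assert (HEw : E w).
    { apply (HE w (ln 4 / (s - s0)) ((f s - f s0) / (s - s0)) HwO).
      - apply Rdiv_lt_0_compat; lra.
      - intros n. specialize (HW n 0%nat). unfold W, V in HW.
        specialize (Hsum n 0%nat). pose proof (Htilt (- h) (prefix w n)).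
        assert (H4 : tilt m l s (s - s0) (prefix w n) <= 4) by lra.
        apply ln_le_compat in H4; [|apply Htilt]. unfold tilt in H4. rewrite ln_exp in H4.
        replace (s - (s - s0)) with s0 in H4 by ring. fold f in H4. rewrite length_prefix in H4.
        apply (Rmult_le_reg_l (s - s0)); [lra|].
        replace ((s - s0) * (ln 4 / (s - s0) - (f s - f s0) / (s - s0) * INR n))
          with (ln 4 - (f s - f s0) * INR n) by (field; lra).
        lra. }
    destruct (Hcov w HEw) as [i Hi].
    destruct (Hu i) as [_ [Hpre _]]. specialize (Hpre w Hi HwO).
    specialize (HW (length (u i)) i). rewrite Hpre in HW.
    assert (Hle : act i * cmass (bmass m l s) (u i) (u i) <=
      sum_f_R0 (fun i' => act i' * cmass (bmass m l s) (u i') (u i)) i).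
    { apply (sum_f_R0_ge_term (fun i' => act i' * cmass (bmass m l s) (u i') (u i))); [|lia].
      intros i' _. apply Rmult_le_pos; [apply Hact|]. now apply cmass_nonneg. }
    rewrite cmass_self in Hle. unfold W, V in HW.
    pose proof (Htilt (s - s0) (u i)). pose proof (Htilt (- h) (u i)).
    (* At [u i] an active cylinder contributes its full mass 1, and an inactive one has ratio above
       4, contributing more than 1/2 through [V]. Both exceed the bound 1/2. *)
    unfold act at 1 in Hle. destruct (Rle_dec (tilt m l s (- h) (u i)) 4); [lra|].
    lra.
Qed.

(** * The dimension formulas *)

Lemma gamma_pos (N : nat) (fam : nat -> Mob) :
  (forall i, (i < N)%nat -> in_MD (fam i)) ->
  (forall i j, (i < N)%nat -> (j < N)%nat -> Some (alpha (fam i)) = beta (fam j)) ->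
  forall i, (i < N)%nat -> 0 < gamma (fam i).
Proof.
  intros Hmd Hab i Hi.
  destruct (common_fixed_point N fam) as [p [Hp Hfix]]; [lia|exact Hab|].
  destruct (Hfix i Hi) as [Ha Hpi]. unfold gamma. rewrite Ha.
  apply (mob_maps_horodiscs (fam i) p Hp (Hmd i Hi) Hpi).
Qed.

Lemma phi_pressure (m : nat) (fam : nat -> Mob) (s : R) :
  phi (S m) fam s = pressure m (fun d => ln (gamma (fam d))) s / ln (INR (S m)).
Proof. unfold phi. replace (S m - 1)%nat with m by lia. reflexivity. Qed.

(** A cover by empty sets costs 0 even at exponent 0. *)
Lemma hausdorff_dim_Lambda_empty (N : nat) (fam : nat -> Mob) :
  (forall w, ~ Lambda N fam w) -> hausdorff_dim N (Lambda N fam) 0.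
Proof.
  intros Hno. split; [now intros s [Hs _]|].
  intros y Hy. apply Hy. split; [lra|].
  intros delta eps _ Heps. exists (fun _ _ => False), (fun _ => 0), (fun _ => 0).
  split; [|split].
  - intros i. split; [intros [x []]|reflexivity].
  - intros w Hw. now elim (Hno w).
  - exists 0. split; [|lra]. intros e He. exists 0%nat. intros n _.
    rewrite sum_eq_R0 by reflexivity. unfold Rdist. rewrite Rminus_diag, Rabs_R0. exact He.
Qed.

(** Serves both cases in which some gamma is below 1; they differ only in where the minimum lies. *)
Lemma hausdorff_dim_Lambda (m j : nat) (fam : nat -> Mob) (s0 : R) :
  (1 <= m)%nat ->
  (forall i, (i < S m)%nat -> in_MD (fam i)) ->
  (forall i j, (i < S m)%nat -> (j < S m)%nat -> Some (alpha (fam i)) = beta (fam j)) ->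
  (j < S m)%nat -> gamma (fam j) < 1 ->
  0 <= s0 -> (forall s, 0 <= s -> phi (S m) fam s0 <= phi (S m) fam s) ->
  hausdorff_dim (S m) (Lambda (S m) fam) (phi (S m) fam s0).
Proof.
  intros Hm Hmd Hab Hj Hgj Hs0 Hmin.
  set (l := fun d => ln (gamma (fam d))).
  assert (HN : 0 < ln (INR (S m))).
  { rewrite <- ln_1. apply ln_increasing; [lra|]. apply (lt_INR 1). lia. }
  assert (Hlj : l j < 0).
  { unfold l. rewrite <- ln_1. apply ln_increasing; [|exact Hgj].
    now apply (gamma_pos (S m) fam). }
  assert (Hphi : forall s, phi (S m) fam s * ln (INR (S m)) = pressure m l s).
  { intros s. rewrite phi_pressure. fold l. field. lra. }
  assert (Hmin' : forall s, 0 <= s -> pressure m l s0 <= pressure m l s).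
  { intros s Hs. rewrite <- !Hphi. apply Rmult_le_compat_r; [lra|]. now apply Hmin. }
  assert (Hdrift := limit_disc_drift (S m) fam ltac:(lia) Hmd Hab). fold l in Hdrift.
  split.
  - intros t [Ht HH]. apply (Rmult_le_reg_r (ln (INR (S m)))); [exact HN|]. rewrite Hphi.
    apply (Hnull_lower m j l (Lambda (S m) fam)); auto; [lia|].
    intros w a e Hw He Hd. split; [exact Hw|]. destruct (Hdrift w Hw) as [_ H].
    now apply (H a e).
  - intros y Hy. apply Rnot_lt_le. intros Hlt.
    (* Positivity makes the exponent [t], halfway between [phi] at [s0] and a supposed larger lower
       bound [y], admissible. *)
    assert (Hpos : 0 < phi (S m) fam s0).
    { apply (Rmult_lt_reg_r (ln (INR (S m)))); [exact HN|]. rewrite Hphi, Rmult_0_l.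
      apply (pressure_pos m j); auto. lia. }
    set (t := (phi (S m) fam s0 + y) / 2).
    assert (Ht : phi (S m) fam s0 < t < y) by (unfold t; lra).
    assert (H : y <= t); [|lra].
    apply Hy. split; [lra|].
    apply (Hnull_upper m l _ s0); auto; [lra| |].
    + rewrite <- Hphi. apply Rmult_lt_compat_r; lra.
    + intros w [Hw Hlim]. split; [exact Hw|]. now apply (Hdrift w Hw).
Qed.

Theorem theorem1p4 (N : nat) (fam : nat -> Mob) :
  (2 <= N)%nat ->
  (forall i, (i < N)%nat -> in_MD (fam i)) ->
  (forall i j, (i < N)%nat -> (j < N)%nat -> i <> j ->
     mob_eval (fam i) <> mob_eval (fam j)) ->
  (forall i j, (i < N)%nat -> (j < N)%nat -> Some (alpha (fam i)) = beta (fam j)) ->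
  ((forall i, (i < N)%nat -> 1 <= gamma (fam i)) ->
     hausdorff_dim N (Lambda N fam) 0) /\
  ((forall i, (i < N)%nat -> gamma (fam i) < 1) ->
     hausdorff_dim N (Lambda N fam) 1) /\
  ((exists i, (i < N)%nat /\ 1 <= gamma (fam i)) ->
   (exists j, (j < N)%nat /\ gamma (fam j) < 1) ->
   exists s0, 0 <= s0 /\ (forall s, 0 <= s -> phi N fam s0 <= phi N fam s) /\
     hausdorff_dim N (Lambda N fam) (phi N fam s0)).
Proof.
  intros HN Hmd _ Hab. destruct N as [|m]; [lia|].
  assert (Hm : (1 <= m)%nat) by lia.
  set (l := fun d => ln (gamma (fam d))).
  assert (HlN : 0 < ln (INR (S m))).
  { rewrite <- ln_1. apply ln_increasing; [lra|]. apply (lt_INR 1). lia. }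
  assert (Hphi : forall s t, pressure m l s <= pressure m l t -> phi (S m) fam s <= phi (S m) fam t).
  { intros s t H. rewrite !phi_pressure. fold l.
    apply Rmult_le_compat_r; [left; now apply Rinv_0_lt_compat|exact H]. }
  split; [|split].
  (* No prefix has product below 1, so no sequence is of limit-disc type. *)
  - intros Hg. apply hausdorff_dim_Lambda_empty. intros w [Hw Hlim].
    destruct (limit_disc_drift (S m) fam ltac:(lia) Hmd Hab w Hw) as [H _].
    destruct (H Hlim 0%nat) as [n [_ Hn]]. fold l in Hn.
    assert (Hl : forall v, Forall (fun d => (d < S m)%nat) v -> 0 <= wsum l v).
    { induction 1 as [|d v Hd _ IH]; simpl; [lra|].
      assert (0 <= l d); [|lra]. unfold l. rewrite <- ln_1.
      apply ln_le_compat; [lra|now apply Hg]. }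
    specialize (Hl (prefix w n) (prefix_Forall w n _ Hw)). lra.
  - intros Hg.
    (* When every gamma is below 1, each term gamma^{-s} increases with [s], so the minimum is at 0,
       where [phi] is log N / log N. *)
    replace 1 with (phi (S m) fam 0)
      by (rewrite phi_pressure, pressure_0; field; lra).
    apply (hausdorff_dim_Lambda m 0); auto; [lra|].
    intros s Hs. apply Hphi, pressure_le_iff. apply sum_Rle. intros d Hd.
    apply exp_le_compat.
    assert (l d < 0); [|nra]. unfold l. rewrite <- ln_1.
    apply ln_increasing; [|apply Hg; lia].
    apply (gamma_pos (S m) fam); auto; lia.
  - intros _ [j [Hj Hgj]].
    destruct (pressure_min_exists m j l) as [s0 [Hs0 Hmin]]; [lia| |].
    { unfold l. rewrite <- ln_1. apply ln_increasing; [|exact Hgj].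
      now apply (gamma_pos (S m) fam). }
    exists s0. assert (Hmin' : forall s, 0 <= s -> phi (S m) fam s0 <= phi (S m) fam s) by auto.
    repeat split; auto; now apply (hausdorff_dim_Lambda m j).
Qed.
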